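(* Let $f$ be a periodic traveling wave with $(E,c)\in\mathbb{G}$ and $c\neq0$ (equivalently $q\neq 0$). If $\rho=1$ but $\kappa\neq q^2$, then the equation $D(\lambda,e^{i\theta})=0$ parametrically describes (for small real $\theta$) two smooth curves passing through the origin tangent to the imaginary axis in a neighborhood of the origin in the complex $\lambda$-plane (the two curves may coincide). If $\rho=-1$, then the equation $D(\lambda,e^{i\theta})=0$ instead parametrically describes, for small real $\theta$, two distinct smooth curves that cross at the origin with tangent lines making acute non-zero angles with the imaginary axis.
   Context: Potential. $V:\mathbb{R}\to\mathbb{R}$ is of class $C^2$, periodic with fundamental period $2\pi$, has exactly two critical points per period, both non-degenerate, and $\min V=-1$, $\max V=1$. Fix a minimizer $\underline u$ and a maximizer $\overline u$ of $V$. Waves. A traveling wave $u=f(z)$, $z=x-ct$, $c\neq\pm1$, of $u_{tt}-u_{xx}+V'(u)=0$ satisfies $(c^2-1)f_{zz}+V'(f)=0$ and $\tfrac12(c^2-1)f_z^2=E-V(f)$. A periodic traveling wave is one with $f_z$ non-constant and periodic; $T>0$ is the smallest number with $f(z+T)=f(z)$ for all $z$ (librational) or $f(z+T)=f(z)\pm2\pi$ for all $z$ (rotational). $\mathbb{G}$ is the set of $(E,c)$ with: $c^2<1,|E|<1$ (subluminal librational); $c^2<1,E<-1$ (subluminal rotational); $c^2>1,|E|<1$ (superluminal librational); or $c^2>1,E>1$ (superluminal rotational). For $(E,c)\in\mathbb{G}$, $f$ is normalized by $f_z(0)>0$ and $f(0)=\overline u$ (if $c^2<1$) or $f(0)=\underline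 u$ (if $c^2>1$). Monodromy. $\mathbf{F}(z,\lambda)$ is the $2\times2$ fundamental matrix, $\mathbf{F}(0,\lambda)=\mathbb{I}$, of $\mathbf{w}_z=\mathbf{A}(z,\lambda)\mathbf{w}$ with $$\mathbf{A}(z,\lambda)=\begin{pmatrix}0&1\\-\frac{\lambda^2+V''(f(z))}{c^2-1}&\frac{2c\lambda}{c^2-1}\end{pmatrix},$$ $\mathbf{M}(\lambda)=\mathbf{F}(T,\lambda)$, $D(\lambda,\mu)=\det(\mathbf{M}(\lambda)-\mu\mathbb{I})$, $$q=\frac{cT}{c^2-1},\qquad \kappa=\frac{M_{12}(0)}{(c^2-1)^2}\int_0^TF_{11}(y,0)^2\,dy,\qquad \rho=\mathrm{sgn}(M_{12}(0)).$$ *)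

(* Defs.v *)
From Stdlib Require Export Reals.
From Coquelicot Require Export Coquelicot.
Open Scope R_scope.

(** * Potential *)

(* [ex_derive_n V 2] alone says nothing about [V] itself being differentiable,
   since [Derive] is total; hence all orders up to 2 are required. *)
Definition class_C2 (g : R -> R) : Prop :=
  (forall (n : nat) (x : R), (n <= 2)%nat -> ex_derive_n g n x) /\
  (forall x : R, continuous (Derive_n g 2) x).

Definition fundamental_period (g : R -> R) (p : R) : Prop :=
  0 < p /\ (forall x, g (x + p) = g x) /\
  (forall p', 0 < p' -> (forall x, g (x + p') = g x) -> p <= p').

Definition two_critical_points_per_period (g : R -> R) (p : R) : Prop :=
  exists a b : R,
    0 <= a < p /\ 0 <= b < p /\ a <> b /\
    (forall x, 0 <= x < p -> (Derive g x = 0 <-> x = a \/ x = b)).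

Definition is_minimizer (g : R -> R) (a : R) : Prop := forall x, g a <= g x.
Definition is_maximizer (g : R -> R) (a : R) : Prop := forall x, g x <= g a.

Record potential (V : R -> R) : Prop := {
  pot_C2 : class_C2 V;
  pot_period : fundamental_period V (2 * PI);
  pot_critical : two_critical_points_per_period V (2 * PI);
  pot_nondegenerate : forall x, Derive V x = 0 -> Derive_n V 2 x <> 0;
  pot_min : exists a, is_minimizer V a /\ V a = -1;
  pot_max : exists a, is_maximizer V a /\ V a = 1
}.

(** * Periodic traveling waves *)

Definition subluminal_librational (E c : R) : Prop := c ^ 2 < 1 /\ Rabs E < 1.
Definition subluminal_rotational (E c : R) : Prop := c ^ 2 < 1 /\ E < -1.
Definition superluminal_librational (E c : R) : Prop := c ^ 2 > 1 /\ Rabs E < 1.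
Definition superluminal_rotational (E c : R) : Prop := c ^ 2 > 1 /\ E > 1.

Definition librational (E c : R) : Prop :=
  subluminal_librational E c \/ superluminal_librational E c.
Definition rotational (E c : R) : Prop :=
  subluminal_rotational E c \/ superluminal_rotational E c.

Definition GG (E c : R) : Prop := librational E c \/ rotational E c.

Definition traveling_wave (V : R -> R) (E c : R) (f : R -> R) : Prop :=
  (forall (n : nat) (z : R), (n <= 2)%nat -> ex_derive_n f n z) /\
  (forall z, (c ^ 2 - 1) * Derive_n f 2 z + Derive V (f z) = 0) /\
  (forall z, / 2 * (c ^ 2 - 1) * (Derive f z) ^ 2 = E - V (f z)).

Definition wave_repeats (E c : R) (f : R -> R) (T : R) : Prop :=
  (librational E c /\ forall z, f (z + T) = f z) \/
  (rotational E c /\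
     ((forall z, f (z + T) = f z + 2 * PI) \/
      (forall z, f (z + T) = f z - 2 * PI))).

Definition wave_period (E c : R) (f : R -> R) (T : R) : Prop :=
  0 < T /\ wave_repeats E c f T /\
  (forall T', 0 < T' -> wave_repeats E c f T' -> T <= T').

(* [umin] and [umax] are the fixed minimizer and maximizer of the potential
   used to normalize the wave at [z = 0]. *)
Record periodic_traveling_wave
    (V : R -> R) (umin umax E c : R) (f : R -> R) (T : R) : Prop := {
  ptw_wave : traveling_wave V E c f;
  ptw_nonconstant : ~ (exists k, forall z, Derive f z = k);
  ptw_periodic : exists p, 0 < p /\ forall z, Derive f (z + p) = Derive f z;
  ptw_period : wave_period E c f T;
  ptw_slope : 0 < Derive f 0;
  ptw_sub : c ^ 2 < 1 -> f 0 = umax;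
  ptw_super : c ^ 2 > 1 -> f 0 = umin
}.

(** * Monodromy matrix *)

(* Coquelicot's matrices are indexed from 0: the (1,2) entry is [entry M 0 1]. *)
Definition entry (M : @matrix C 2 2) (i j : nat) : C := coeff_mat (RtoC 0) M i j.

Definition mat2 (m11 m12 m21 m22 : C) : @matrix C 2 2 :=
  mk_matrix 2 2 (fun i j =>
    match i, j with
    | 0%nat, 0%nat => m11
    | 0%nat, _ => m12
    | _, 0%nat => m21
    | _, _ => m22
    end).

Definition det2 (M : @matrix C 2 2) : C :=
  (entry M 0 0 * entry M 1 1 - entry M 0 1 * entry M 1 0)%C.

Definition Amat (V : R -> R) (c : R) (f : R -> R) (z : R) (lambda : C) :
    @matrix C 2 2 :=
  mat2 (RtoC 0) (RtoC 1)
       (- ((lambda * lambda + RtoC (Derive_n V 2 (f z))) / RtoC (c ^ 2 - 1)))%C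
       (RtoC (2 * c) * lambda / RtoC (c ^ 2 - 1))%C.

(* Fundamental matrix of [w_z = A(z,lambda) w], with the z-derivative of the
   complex entries taken along the real variable z. *)
Definition fundamental_matrix
    (A : R -> C -> @matrix C 2 2) (F : R -> C -> @matrix C 2 2) : Prop :=
  (forall lambda, F 0 lambda = (Mone : @matrix C_Ring 2 2)) /\
  (forall (lambda : C) (z : R) (i j : nat), (i < 2)%nat -> (j < 2)%nat ->
     @is_derive R_AbsRing C_R_NormedModule
       (fun y => entry (F y lambda) i j) z
       (entry (Mmult (T := C_Ring) (A z lambda) (F z lambda)) i j)).

Definition DD (F : R -> C -> @matrix C 2 2) (T : R) (lambda mu : C) : C :=
  det2 (@minus (matrix_AbelianGroup (G := C_AbelianGroup) (m := 2) (n := 2))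
          (F T lambda) (mat2 mu (RtoC 0) (RtoC 0) mu)).

Definition q_of (c T : R) : R := c * T / (c ^ 2 - 1).

(* The system is real at [lambda = 0], so the entries of F(z,0) are real
   numbers; [Re] only converts them to type [R]. *)
Definition F0 (F : R -> C -> @matrix C 2 2) (z : R) (i j : nat) : R :=
  Re (entry (F z (RtoC 0)) i j).

Definition kappa_of (F : R -> C -> @matrix C 2 2) (c T : R) : R :=
  F0 F T 0 1 / (c ^ 2 - 1) ^ 2 * RInt (fun y => (F0 F y 0 0) ^ 2) 0 T.

Definition rho_of (F : R -> C -> @matrix C 2 2) (T : R) : R := sign (F0 F T 0 1).

(** * Plane curves *)

Definition expi (theta : R) : C := (cos theta, sin theta).

Definition velocity (g : R -> C) (t : R) : C :=
  (Derive (fun s => Re (g s)) t, Derive (fun s => Im (g s)) t).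

(* A regular C^infinity parametrization over (-d,d) passing through the origin
   at parameter 0. *)
Definition smooth_curve_through_0 (d : R) (g : R -> C) : Prop :=
  g 0 = RtoC 0 /\
  (forall t, Rabs t < d ->
     (forall n : nat, ex_derive_n (fun s => Re (g s)) n t /\
                      ex_derive_n (fun s => Im (g s)) n t) /\
     velocity g t <> RtoC 0).

Definition curve_trace (g : R -> C) (d : R) (p : C) : Prop :=
  exists t, Rabs t < d /\ g t = p.

(* Unsigned angle, in [0, PI/2], between the real line spanned by the nonzero
   vector [v] and the imaginary axis. *)
Definition angle_with_imaginary_axis (v : C) : R := acos (Rabs (Im v) / Cmod v).

Definition tangent_to_imaginary_axis (g : R -> C) : Prop :=
  Re (velocity g 0) = 0.

Definition parallel (v w : C) : Prop := Re v * Im w = Im v * Re w.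

(* For each real [theta] in (-d,d), the zeros of [D(., e^{i theta})] in the disc
   of radius [r] are exactly [g1 theta] and [g2 theta]. *)
Definition described_by (D : C -> C -> C) (d r : R) (g1 g2 : R -> C) : Prop :=
  forall theta, Rabs theta < d -> forall lambda : C,
    (Cmod lambda < r /\ D lambda (expi theta) = RtoC 0) <->
    (lambda = g1 theta \/ lambda = g2 theta).

Definition two_tangent_curves (D : C -> C -> C) : Prop :=
  exists (d r : R) (g1 g2 : R -> C),
    0 < d /\ 0 < r /\
    smooth_curve_through_0 d g1 /\ smooth_curve_through_0 d g2 /\
    described_by D d r g1 g2 /\
    tangent_to_imaginary_axis g1 /\ tangent_to_imaginary_axis g2.

Definition two_crossing_curves (D : C -> C -> C) : Prop :=
  exists (d r : R) (g1 g2 : R -> C),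
    0 < d /\ 0 < r /\
    smooth_curve_through_0 d g1 /\ smooth_curve_through_0 d g2 /\
    described_by D d r g1 g2 /\
    (* distinct as point sets, however close to the origin one looks *)
    (forall e, 0 < e <= d ->
       ~ (forall p, curve_trace g1 e p <-> curve_trace g2 e p)) /\
    ~ parallel (velocity g1 0) (velocity g2 0) /\
    0 < angle_with_imaginary_axis (velocity g1 0) < PI / 2 /\
    0 < angle_with_imaginary_axis (velocity g2 0) < PI / 2.

(* Main.v *)
Require Import Defs.
From Stdlib Require Import Reals Lra Lia IndefiniteDescription.
From Coquelicot Require Import Coquelicot.
Open Scope R_scope.

(** Near lambda = 0 the two roots mu of D(lambda, mu) = 0, the Floquet
    multipliers, are holomorphic functions of lambda whose derivatives at 0 are
    nonzero in both regimes of the theorem.  Each of the two curves is the preimage of the unit circle mu = e^(i theta)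
    under one of them, and the slope at the origin is read off from the
    derivative.

    The substitution w = e^(k z) u with k = c lambda / (c^2 - 1) turns the
    first-order system into Hill's equation u'' = (Q + nu) u, where
    Q = - V''(f) / (c^2 - 1) and nu = lambda^2 / (c^2 - 1)^2
    (hill_of_fundamental).  Its Wronskian is constant, so that, with
    e = e^(q lambda) and Delta(nu) the trace of the Hill monodromy matrix,
    D(lambda, mu) = mu^2 - e Delta(nu) mu + e^2 (characteristic_polynomial).

    At nu = 0 differentiating the wave equation shows that f_z solves Hill's
    equation.  It is periodic, and f_zz(0) = 0 because f(0) is a critical point
    of V, so the monodromy matrix is unipotent upper triangular.  Variation of
    constants then gives Delta(nu) = 2 + nu G(nu), where G is a convergent power
    series in nu, the Neumann series of a Volterra equation, with
    G(0) = M_12(0) int_0^T F_11^2 (hill_discriminant).  Written in lambda, this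
    is Delta = 2 + lambda^2 H(lambda) with H holomorphic and H(0) = kappa
    (DD_normal_form).

    The discriminant of the quadratic is
    e^2 (Delta^2 - 4) = 4 e^2 lambda^2 (H + lambda^2 H^2 / 4).  When kappa <> 0
    the last factor has a holomorphic square root S near 0, with
    S(0)^2 = kappa (smooth_sqrt), so the roots are
    mu = e (1 + lambda^2 H / 2 +- lambda S), with derivatives q +- sqrt(kappa)
    at 0.  If these do not vanish, the holomorphic inverse function theorem
    (inverse_function) solves mu = e^(i theta) by lambda = g(theta) with
    g'(0) = i / (q +- sqrt(kappa)), and leaves no other solution in a small disc
    (branch_curve, two_branches).

    The sign of kappa is rho.  For rho = 1 the square root is real, the
    condition kappa <> q^2 says that neither derivative vanishes, and both
    tangents are imaginary.  For rho = -1 the square root is i s with s > 0, and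
    since q <> 0 the velocities (s, q) / (q^2 + s^2) and (-s, q) / (q^2 + s^2)
    are oblique and lie in adjacent quadrants (holomorphic_quadrant), which
    separates the two traces. *)

(** * Complex derivatives *)

(** The complex field is normed over itself by the modulus here, which makes
    the general sum, product and chain rules apply. *)
Definition cderiv (f : C -> C) (z l : C) : Prop :=
  @is_derive C_AbsRing (AbsRing_NormedModule C_AbsRing) f z l.

(** Needed wherever no differentiation rule applies: inverse maps, the
    exponential at 0, sums of power series and restriction to real lines. *)
Lemma cderiv_bound (f : C -> C) (z l : C) :
  cderiv f z l <->
  forall eps : R, 0 < eps -> exists delta : R, 0 < delta /\
    forall h : C, Cmod h < delta ->
      Cmod (f (z + h) - f z - h * l)%C <= eps * Cmod h.
Proof.
  split.
  - intros [_ H] eps Heps.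
    destruct (H z (fun P HP => HP) (mkposreal eps Heps)) as [d Hd].
    exists d; split; [apply cond_pos|]. intros h Hh.
    specialize (Hd (z + h)%C).
    assert (E : minus (z + h)%C z = h :> C)
      by (change (z + h - z = h)%C; ring).
    assert (B : Cmod (f (z + h) - f z - h * l)%C <= eps * Cmod h).
    { replace (f (z + h) - f z - h * l)%C
        with (f (z + h) - f z - (z + h - z) * l)%C by ring.
      replace (Cmod h) with (Cmod (z + h - z)%C) by (f_equal; ring).
      apply Hd. change (Cmod (z + h - z)%C < d).
      replace (z + h - z)%C with h by ring. exact Hh. }
    exact B.
  - intros H. split; [apply is_linear_scal_l|].
    intros x Hx.
    apply (@is_filter_lim_locally_unique C_AbsRing
             (AbsRing_NormedModule C_AbsRing)) in Hx.
    subst x. intros eps. destruct (H eps (cond_pos eps)) as (d & Hd & B).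
    exists (mkposreal d Hd). refine (fun (y : C) Hy => _).
    change (Cmod (f y - f z - (y - z) * l)%C <= eps * Cmod (y - z)%C).
    change (Cmod (y - z)%C < d) in Hy.
    specialize (B _ Hy).
    replace (z + (y - z))%C with y in B by ring. exact B.
Qed.

Lemma cderiv_const (a z : C) : cderiv (fun _ => a) z 0.
Proof. exact (@is_derive_const C_AbsRing (AbsRing_NormedModule C_AbsRing) a z). Qed.

Lemma cderiv_id (z : C) : cderiv (fun x => x) z 1.
Proof. exact (@is_derive_id C_AbsRing z). Qed.

Lemma cderiv_plus (f g : C -> C) (z lf lg : C) :
  cderiv f z lf -> cderiv g z lg -> cderiv (fun x => f x + g x)%C z (lf + lg)%C.
Proof. exact (@is_derive_plus C_AbsRing (AbsRing_NormedModule C_AbsRing) f g z lf lg). Qed.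

Lemma cderiv_mult (f g : C -> C) (z lf lg : C) :
  cderiv f z lf -> cderiv g z lg ->
  cderiv (fun x => f x * g x)%C z (lf * g z + f z * lg)%C.
Proof.
  intros Hf Hg.
  exact (@is_derive_mult C_AbsRing f g z lf lg Hf Hg Cmult_comm).
Qed.

Lemma cderiv_comp (f g : C -> C) (z lf lg : C) :
  cderiv f (g z) lf -> cderiv g z lg -> cderiv (fun x => f (g x)) z (lg * lf)%C.
Proof. exact (@is_derive_comp C_AbsRing (AbsRing_NormedModule C_AbsRing) f g z lf lg). Qed.

Lemma cderiv_eq (f : C -> C) (z l l' : C) : cderiv f z l -> l = l' -> cderiv f z l'.
Proof. now intros H <-. Qed.

Lemma Cmod_sub_triangle (a b : C) : Cmod a - Cmod b <= Cmod (a - b)%C.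
Proof.
  pose proof (Cmod_triangle (a - b)%C b) as H.
  replace (a - b + b)%C with a in H by ring. lra.
Qed.

Lemma Cmod_opp_sub (a b : C) : Cmod (a - b)%C = Cmod (b - a)%C.
Proof. rewrite <- Cmod_opp. f_equal. ring. Qed.

Lemma cderiv_continuous (f : C -> C) (z l : C) :
  cderiv f z l -> forall eps : R, 0 < eps -> exists delta : R, 0 < delta /\
    forall h : C, Cmod h < delta -> Cmod (f (z + h) - f z)%C < eps.
Proof.
  intros H eps Heps.
  destruct (proj1 (cderiv_bound f z l) H 1 Rlt_0_1) as (d & Hd & B).
  pose proof (Cmod_ge_0 l).
  exists (Rmin d (eps / (1 + Cmod l))). split.
  { apply Rmin_glb_lt; [lra|]. apply Rdiv_lt_0_compat; lra. }
  intros h Hh.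
  assert (H1 : Cmod h < d) by (eapply Rlt_le_trans; [exact Hh|apply Rmin_l]).
  assert (H2 : Cmod h < eps / (1 + Cmod l)) by (eapply Rlt_le_trans; [exact Hh|apply Rmin_r]).
  specialize (B h H1).
  pose proof (Cmod_triangle (f (z + h) - f z - h * l)%C (h * l)%C) as Tr.
  replace (f (z + h) - f z - h * l + h * l)%C with (f (z + h) - f z)%C in Tr by ring.
  rewrite Cmod_mult in Tr.
  apply Rle_lt_trans with (Cmod h * (1 + Cmod l)); [lra|].
  apply (Rmult_lt_compat_r (1 + Cmod l)) in H2; [|lra].
  replace (eps / (1 + Cmod l) * (1 + Cmod l)) with eps in H2 by (field; lra).
  exact H2.
Qed.

(** The lower bound on increments makes k = g(y + h) - g(y) of order h, so that
    the error of h = f(g(y) + k) - f(g(y)) against l k is o(h), and dividing by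
    l gives the claim. *)
Lemma cderiv_inverse (f g : C -> C) (y l : C) (a d : R) :
  0 < a -> 0 < d ->
  (forall h, Cmod h < d -> f (g (y + h)%C) = (y + h)%C) ->
  (forall h, Cmod h < d -> a * Cmod (g (y + h)%C - g y)%C <= Cmod h) ->
  l <> 0 -> cderiv f (g y) l -> cderiv g y (/ l)%C.
Proof.
  intros Ha Hd Hfg Hlip Hl Hf. apply cderiv_bound. intros eps Heps.
  pose proof (Cmod_gt_0 l) as [Hl1 _]. specialize (Hl1 Hl).
  assert (He : 0 < eps * a * Cmod l).
  { apply Rmult_lt_0_compat; [apply Rmult_lt_0_compat|]; assumption. }
  destruct (proj1 (cderiv_bound f (g y) l) Hf _ He) as (d' & Hd' & B).
  exists (Rmin d (a * d')). split.
  { apply Rmin_glb_lt; [assumption|]. now apply Rmult_lt_0_compat. }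
  intros h Hh.
  assert (H1 : Cmod h < d) by (eapply Rlt_le_trans; [exact Hh|apply Rmin_l]).
  assert (H2 : Cmod h < a * d') by (eapply Rlt_le_trans; [exact Hh|apply Rmin_r]).
  set (k := (g (y + h) - g y)%C).
  assert (Hk : a * Cmod k <= Cmod h) by (apply Hlip; exact H1).
  assert (Hk' : Cmod k < d') by nra.
  specialize (B k Hk').
  replace (g y + k)%C with (g (y + h)%C) in B by (unfold k; ring).
  rewrite Hfg in B by assumption.
  assert (H0 : f (g y) = y).
  { specialize (Hfg 0). rewrite Cmod_0 in Hfg. specialize (Hfg Hd).
    now replace (y + 0)%C with y in Hfg by ring. }
  rewrite H0 in B.
  replace (y + h - y - k * l)%C with (- (l * (k - h * / l)))%C in B
    by (now field).
  rewrite Cmod_opp, Cmod_mult in B.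
  apply Rmult_le_reg_l with (Cmod l); [assumption|].
  eapply Rle_trans; [exact B|].
  replace (eps * a * Cmod l * Cmod k) with (eps * Cmod l * (a * Cmod k)) by ring.
  replace (Cmod l * (eps * Cmod h)) with (eps * Cmod l * Cmod h) by ring.
  apply Rmult_le_compat_l; [nra|assumption].
Qed.

(** The remainder is exactly h^2 / (z^2 (z + h)). *)
Lemma cderiv_inv (z : C) : z <> 0 -> cderiv (fun x => / x)%C z (- (/ z * / z))%C.
Proof.
  intros Hz. pose proof (Cmod_gt_0 z) as [Hz1 _]. specialize (Hz1 Hz).
  apply cderiv_bound. intros eps Heps.
  set (m := Cmod z) in *.
  assert (He : 0 < eps * (m * m * m) / 2) by
    (repeat apply Rmult_lt_0_compat; lra).
  exists (Rmin (m / 2) (eps * (m * m * m) / 2)). split.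
  { apply Rmin_glb_lt; lra. }
  intros h Hh.
  assert (H1 : Cmod h < m / 2) by (eapply Rlt_le_trans; [exact Hh|apply Rmin_l]).
  assert (H2 : Cmod h < eps * (m * m * m) / 2) by (eapply Rlt_le_trans; [exact Hh|apply Rmin_r]).
  assert (Hzh : m / 2 < Cmod (z + h)%C).
  { pose proof (Cmod_sub_triangle z (- h)%C) as Tr. rewrite Cmod_opp in Tr.
    replace (z - - h)%C with (z + h)%C in Tr by ring. fold m in Tr. lra. }
  assert (Hn : (z + h)%C <> 0).
  { intros E. rewrite E, Cmod_0 in Hzh. lra. }
  replace (/ (z + h) - / z - h * - (/ z * / z))%C
    with (h * h * / (z * z * (z + h)))%C by (field; auto).
  rewrite !Cmod_mult, Cmod_inv, !Cmod_mult.
  - fold m. rewrite (Rmult_comm eps), Rmult_assoc.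
    apply Rmult_le_compat_l; [apply Cmod_ge_0|].
    apply Rmult_le_reg_r with (m * m * Cmod (z + h)).
    { apply Rmult_lt_0_compat; nra. }
    rewrite Rmult_assoc, Rinv_l, Rmult_1_r.
    + apply Rle_trans with (eps * (m * m * (m / 2))); [lra|].
      apply Rmult_le_compat_l; [lra|]. apply Rmult_le_compat_l; nra.
    + apply Rgt_not_eq, Rmult_lt_0_compat; nra.
  - intros E. apply (f_equal Cmod) in E. rewrite !Cmod_mult, Cmod_0 in E.
    fold m in E. assert (0 < m * m * Cmod (z + h)) by (apply Rmult_lt_0_compat; nra). lra.
Qed.

Lemma cderiv_unique (f : C -> C) (z l l' : C) :
  cderiv f z l -> cderiv f z l' -> l = l'.
Proof.
  intros H H'. apply Ceq_minus, Cmod_eq_0.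
  apply Rle_antisym; [|apply Cmod_ge_0]. apply Rnot_lt_le. intros L.
  set (eps := Cmod (l - l')%C / 4).
  assert (He : 0 < eps) by (unfold eps; lra).
  destruct (proj1 (cderiv_bound _ _ _) H eps He) as (d & Hd & B).
  destruct (proj1 (cderiv_bound _ _ _) H' eps He) as (d' & Hd' & B').
  set (s := Rmin d d' / 2).
  assert (Hs : 0 < s) by (unfold s; pose proof (Rmin_glb_lt _ _ _ Hd Hd'); lra).
  pose proof (Rmin_l d d'). pose proof (Rmin_r d d').
  assert (Hm : Cmod (RtoC s) = s) by (rewrite Cmod_R; apply Rabs_pos_eq; lra).
  specialize (B (RtoC s)). specialize (B' (RtoC s)). rewrite Hm in B, B'.
  assert (X1 : s < d) by (unfold s in *; lra).
  assert (X2 : s < d') by (unfold s in *; lra).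
  specialize (B X1). specialize (B' X2).
  pose proof (Cmod_triangle (f (z + s) - f z - s * l')%C (- (f (z + s) - f z - s * l))%C) as Tr.
  rewrite Cmod_opp in Tr.
  replace (f (z + s) - f z - s * l' + - (f (z + s) - f z - s * l))%C
    with (s * (l - l'))%C in Tr by ring.
  rewrite Cmod_mult, Hm in Tr.
  assert (s * Cmod (l - l')%C <= s * (2 * eps)) by lra.
  apply Rmult_le_reg_l in H2; [|exact Hs]. unfold eps in H2. lra.
Qed.

(** Carries real one-variable calculus over to holomorphic functions; imaginary
    parts are obtained by applying it to - i f. *)
Lemma cderiv_Re_line (f : C -> C) (x w l : C) (t : R) :
  cderiv f (x + RtoC t * w)%C l ->
  is_derive (fun s : R => Re (f (x + RtoC s * w)%C)) t (Re (w * l)%C).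
Proof.
  intros Hf. split; [apply is_linear_scal_l|].
  intros t0 Ht0.
  apply (@is_filter_lim_locally_unique R_AbsRing (AbsRing_NormedModule R_AbsRing)) in Ht0.
  subst t0. intros eps.
  pose proof (Cmod_ge_0 w) as Hw.
  assert (He : 0 < eps / (1 + Cmod w)) by (apply Rdiv_lt_0_compat; [apply cond_pos|lra]).
  destruct (proj1 (cderiv_bound _ _ _) Hf _ He) as (d & Hd & B).
  assert (Hdw : 0 < d / (1 + Cmod w)) by (apply Rdiv_lt_0_compat; lra).
  exists (mkposreal _ Hdw). intros u Hu.
  change (Rabs (u - t) < d / (1 + Cmod w)) in Hu.
  change (Rabs (Re (f (x + RtoC u * w)%C) - Re (f (x + RtoC t * w)%C)
                - (u - t) * Re (w * l)%C) <= eps * Rabs (u - t)).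
  assert (Hh : Cmod (RtoC (u - t) * w)%C = Rabs (u - t) * Cmod w)
    by now rewrite Cmod_mult, Cmod_R.
  pose proof (Rabs_pos (u - t)) as Hut.
  assert (Hhd : Cmod (RtoC (u - t) * w)%C < d).
  { rewrite Hh. apply Rle_lt_trans with (Rabs (u - t) * (1 + Cmod w)); [nra|].
    apply (Rmult_lt_compat_r (1 + Cmod w)) in Hu; [|lra].
    replace (d / (1 + Cmod w) * (1 + Cmod w)) with d in Hu by (field; lra).
    exact Hu. }
  specialize (B _ Hhd).
  replace (x + RtoC t * w + RtoC (u - t) * w)%C with (x + RtoC u * w)%C in B
    by (rewrite RtoC_minus; ring).
  replace (Re (f (x + RtoC u * w)%C) - Re (f (x + RtoC t * w)%C) - (u - t) * Re (w * l)%C)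
    with (Re (f (x + RtoC u * w) - f (x + RtoC t * w) - RtoC (u - t) * w * l)%C).
  2:{ destruct (f (x + RtoC u * w)%C), (f (x + RtoC t * w)%C), l, w. simpl. ring. }
  eapply Rle_trans; [apply re_le_Cmod|]. eapply Rle_trans; [exact B|].
  rewrite Hh. apply Rmult_le_reg_r with (1 + Cmod w); [lra|].
  replace (eps / (1 + Cmod w) * (Rabs (u - t) * Cmod w) * (1 + Cmod w))
    with (eps * Rabs (u - t) * Cmod w) by (field; lra).
  apply Rmult_le_compat_l; [|lra].
  apply Rmult_le_pos; [left; apply cond_pos|exact Hut].
Qed.

(** With v = f(y) - f(x), the real mean value theorem for Re(conj(v) f) on the
    segment gives |v|^2 <= |v| M |y - x|. *)
Lemma cderiv_mean_value (f f' : C -> C) (x y : C) (M : R) :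
  (forall t : R, 0 <= t <= 1 -> cderiv f (x + RtoC t * (y - x))%C (f' (x + RtoC t * (y - x))%C)) ->
  (forall t : R, 0 <= t <= 1 -> Cmod (f' (x + RtoC t * (y - x))%C) <= M) ->
  Cmod (f y - f x)%C <= M * Cmod (y - x)%C.
Proof.
  intros Hd Hb.
  set (v := (f y - f x)%C).
  set (phi := fun t : R => Re (Cconj v * f (x + RtoC t * (y - x)))%C).
  set (dphi := fun t : R =>
    Re ((y - x) * (0 * f (x + RtoC t * (y - x)) + Cconj v * f' (x + RtoC t * (y - x))))%C).
  assert (Hphi : forall t, 0 <= t <= 1 -> is_derive phi t (dphi t)).
  { intros t Ht.
    apply (cderiv_Re_line (fun z => Cconj v * f z)%C).
    apply (cderiv_mult (fun _ => Cconj v) f); [apply cderiv_const|auto]. }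
  destruct (MVT_gen phi 0 1 dphi) as (xi & Hxi & E).
  - intros t Ht. rewrite Rmin_left, Rmax_right in Ht by lra. apply Hphi; lra.
  - intros t Ht. rewrite Rmin_left, Rmax_right in Ht by lra.
    apply continuity_pt_filterlim.
    apply (ex_derive_continuous phi). exists (dphi t). now apply Hphi.
  - rewrite Rmin_left, Rmax_right in Hxi by lra.
    assert (E2 : phi 1 - phi 0 = Cmod v * Cmod v).
    { unfold phi. replace (x + RtoC 1 * (y - x))%C with y by ring.
      replace (x + RtoC 0 * (y - x))%C with x by ring.
      unfold Cmod. rewrite sqrt_sqrt.
      2:{ pose proof (pow2_ge_0 (fst v)). pose proof (pow2_ge_0 (snd v)). lra. }
      unfold v. destruct (f y), (f x). simpl. ring. }
    assert (E3 : dphi xi <= Cmod v * (Cmod (y - x)%C * M)).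
    { eapply Rle_trans; [apply Rle_abs|]. unfold dphi.
      eapply Rle_trans; [apply re_le_Cmod|].
      rewrite Cmult_0_l, Cplus_0_l, !Cmod_mult, Cmod_conj.
      pose proof (Hb xi Hxi). pose proof (Cmod_ge_0 v). pose proof (Cmod_ge_0 (y - x)%C).
      rewrite <- Rmult_assoc, (Rmult_comm (Cmod (y - x)%C)), Rmult_assoc.
      apply Rmult_le_compat_l; [assumption|]. now apply Rmult_le_compat_l. }
    rewrite Rminus_0_r, Rmult_1_r in E.
    pose proof (Cmod_ge_0 v). destruct (Req_dec (Cmod v) 0) as [Z|Z].
    + rewrite Z. apply Rmult_le_pos; [|apply Cmod_ge_0].
      eapply Rle_trans; [apply Cmod_ge_0|apply (Hb 0); lra].
    + apply Rmult_le_reg_l with (Cmod v); [lra|]. nra.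
Qed.

(** * Smoothness on discs and contractions *)

(** The derivative is quantified existentially at every order, so that closure
    under an operation is an induction on the order along its differentiation
    rule, without uniqueness of derivatives. *)
Fixpoint Cdiff (n : nat) (r : R) (f : C -> C) : Prop :=
  match n with
  | O => True
  | S n => exists f' : C -> C,
      (forall z, Cmod z < r -> cderiv f z (f' z)) /\ Cdiff n r f'
  end.

(** All orders share the same disc, which is what makes the final curves
    infinitely differentiable on one interval. *)
Definition Csmooth (r : R) (f : C -> C) : Prop := forall n, Cdiff n r f.

Lemma Cdiff_pred n : forall r f, Cdiff (S n) r f -> Cdiff n r f.
Proof.
  induction n as [|n IH]; intros r f H; [exact I|].
  destruct H as (f' & H1 & H2). exists f'; auto.
Qed.

Lemma Cdiff_shrink n : forall r r' f, r' <= r -> Cdiff n r f -> Cdiff n r' f.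
Proof.
  induction n as [|n IH]; intros r r' f Hr H; [exact I|].
  destruct H as (f' & H1 & H2). exists f'; split; [|eauto].
  intros z Hz. apply H1. lra.
Qed.

Lemma Cdiff_const n : forall r a, Cdiff n r (fun _ => a).
Proof.
  induction n as [|n IH]; intros r a; [exact I|].
  exists (fun _ => RtoC 0). split; [intros; apply cderiv_const|apply IH].
Qed.

Lemma Cdiff_id n : forall r, Cdiff n r (fun z => z).
Proof.
  destruct n as [|n]; intros r; [exact I|].
  exists (fun _ => RtoC 1). split; [intros; apply cderiv_id|apply Cdiff_const].
Qed.

Lemma Cdiff_plus n : forall r f g,
  Cdiff n r f -> Cdiff n r g -> Cdiff n r (fun z => f z + g z)%C.
Proof.
  induction n as [|n IH]; intros r f g Hf Hg; [exact I|].
  destruct Hf as (f' & F1 & F2), Hg as (g' & G1 & G2).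
  exists (fun z => f' z + g' z)%C. split; [|auto].
  intros z Hz. apply cderiv_plus; auto.
Qed.

Lemma Cdiff_mult n : forall r f g,
  Cdiff n r f -> Cdiff n r g -> Cdiff n r (fun z => f z * g z)%C.
Proof.
  induction n as [|n IH]; intros r f g Hf Hg; [exact I|].
  pose proof (Cdiff_pred _ _ _ Hf) as Hf0. pose proof (Cdiff_pred _ _ _ Hg) as Hg0.
  destruct Hf as (f' & F1 & F2), Hg as (g' & G1 & G2).
  exists (fun z => f' z * g z + f z * g' z)%C. split.
  - intros z Hz. apply cderiv_mult; auto.
  - apply Cdiff_plus; auto.
Qed.

Lemma Cdiff_comp n : forall r r' f g,
  (forall z, Cmod z < r -> Cmod (g z) < r') ->
  Cdiff n r' f -> Cdiff n r g -> Cdiff n r (fun z => f (g z)).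
Proof.
  induction n as [|n IH]; intros r r' f g Hmap Hf Hg; [exact I|].
  pose proof (Cdiff_pred _ _ _ Hg) as Hg0.
  destruct Hf as (f' & F1 & F2), Hg as (g' & G1 & G2).
  exists (fun z => g' z * f' (g z))%C. split.
  - intros z Hz. apply cderiv_comp; auto.
  - apply Cdiff_mult; eauto.
Qed.

(** By the rule (1/f)' = - f' (1/f) (1/f), in which the factors 1/f are of the
    preceding order. *)
Lemma Cdiff_inv n : forall r (f : C -> C),
  (forall z, Cmod z < r -> f z <> 0) ->
  Cdiff n r f -> Cdiff n r (fun z => / f z)%C.
Proof.
  induction n as [|n IH]; intros r f Hn Hf; [exact I|].
  pose proof (Cdiff_pred _ _ _ Hf) as Hf0.
  destruct Hf as (f' & F1 & F2).
  exists (fun z => f' z * (RtoC (-1) * (/ f z * / f z)))%C. split.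
  - intros z Hz.
    apply (cderiv_eq _ _ (f' z * - (/ f z * / f z))%C); [|ring].
    apply (cderiv_comp Cinv f); auto. apply cderiv_inv; auto.
  - repeat apply Cdiff_mult; auto. apply Cdiff_const.
Qed.

Lemma Csmooth_deriv r f z : Csmooth r f -> Cmod z < r -> exists l, cderiv f z l.
Proof. intros H Hz. destruct (H 1%nat) as (f' & H1 & _). eauto. Qed.

Lemma Csmooth_continuous_0 r (f : C -> C) : 0 < r -> Csmooth r f ->
  forall eps, 0 < eps -> exists d, 0 < d <= r /\
    forall z, Cmod z < d -> Cmod (f z - f 0)%C < eps.
Proof.
  intros Hr Hf eps He.
  destruct (Csmooth_deriv r f 0 Hf) as (l & Hl); [now rewrite Cmod_0|].
  destruct (cderiv_continuous _ _ _ Hl eps He) as (d & Hd & B).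
  exists (Rmin d r). split; [split; [now apply Rmin_glb_lt|apply Rmin_r]|].
  intros z Hz. specialize (B z). replace (0 + z)%C with z in B by ring.
  apply B. eapply Rlt_le_trans; [exact Hz|apply Rmin_l].
Qed.

(** The intervals [a_n - 2 e_n, a_n + 2 e_n], with e_n = M / 2^n, are nested. *)
Lemma geometric_limit_R (a : nat -> R) (M : R) :
  (forall n, Rabs (a (S n) - a n) <= M / 2 ^ n) ->
  exists l, forall n, Rabs (a n - l) <= 2 * M / 2 ^ n.
Proof.
  intros H.
  assert (Hp : forall n, 0 < 2 ^ n) by (intros; apply pow_lt; lra).
  set (e := fun n : nat => M / 2 ^ n).
  assert (Hh : forall n, e (S n) = e n / 2)
    by (intros n; unfold e; simpl; field; apply Rgt_not_eq, Hp).
  assert (Ha : forall n, - e n <= a (S n) - a n <= e n)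
    by (intros n; apply Rabs_le_between; exact (H n)).
  assert (He : forall n, 0 <= e n).
  { intros n. specialize (Ha n). lra. }
  assert (Hm : forall n k, a n - 2 * e n <= a (n + k)%nat - 2 * e (n + k)%nat /\
                          a (n + k)%nat + 2 * e (n + k)%nat <= a n + 2 * e n).
  { intros n k. induction k as [|k IH]; [rewrite Nat.add_0_r; lra|].
    rewrite Nat.add_succ_r. rewrite Hh.
    pose proof (Ha (n + k)%nat). lra. }
  assert (Hlr : forall n m, a n - 2 * e n <= a m + 2 * e m).
  { intros n m. destruct (Nat.le_ge_cases n m) as [L|L].
    - replace m with (n + (m - n))%nat by lia.
      pose proof (Hm n (m - n)%nat). pose proof (He (n + (m - n))%nat). lra.
    - replace n with (m + (n - m))%nat by lia.
      pose proof (Hm m (n - m)%nat). pose proof (He (m + (n - m))%nat). lra. }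
  destruct (completeness (fun x => exists n, x = a n - 2 * e n)) as (l & U & L).
  - exists (a O + 2 * e O). intros x (n & ->). apply Hlr.
  - exists (a O - 2 * e O), O. reflexivity.
  - exists l. intros n. replace (2 * M / 2 ^ n) with (2 * e n)
      by (unfold e; field; apply Rgt_not_eq, Hp).
    assert (a n - 2 * e n <= l) by (apply U; now exists n).
    assert (l <= a n + 2 * e n) by (apply L; intros x (m & ->); apply Hlr).
    apply Rabs_le. lra.
Qed.

Lemma Cmod_le_Re_Im (z : C) : Cmod z <= Rabs (Re z) + Rabs (Im z).
Proof.
  replace z with (RtoC (Re z) + Ci * RtoC (Im z))%C at 1
    by (destruct z; unfold Cplus, Cmult, Ci, RtoC; simpl; f_equal; ring).
  eapply Rle_trans; [apply Cmod_triangle|].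
  rewrite Cmod_mult, !Cmod_R, Cmod_Ci. lra.
Qed.

Lemma Im_le_Cmod (z : C) : Rabs (Im z) <= Cmod z.
Proof.
  eapply Rle_trans; [|apply Rmax_Cmod]. apply Rmax_r.
Qed.

Lemma geometric_limit_C (a : nat -> C) (M : R) :
  (forall n, Cmod (a (S n) - a n)%C <= M / 2 ^ n) ->
  exists l, forall n, Cmod (a n - l)%C <= 4 * M / 2 ^ n.
Proof.
  intros H.
  destruct (geometric_limit_R (fun n => Re (a n)) M) as (x & Hx).
  { intros n. eapply Rle_trans; [|apply H].
    eapply Rle_trans; [|apply re_le_Cmod]. apply Req_le; reflexivity. }
  destruct (geometric_limit_R (fun n => Im (a n)) M) as (y & Hy).
  { intros n. eapply Rle_trans; [|apply H].
    eapply Rle_trans; [|apply Im_le_Cmod]. apply Req_le; reflexivity. }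
  exists (x, y). intros n. eapply Rle_trans; [apply Cmod_le_Re_Im|].
  specialize (Hx n). specialize (Hy n).
  replace (4 * M / 2 ^ n) with (2 * M / 2 ^ n + 2 * M / 2 ^ n) by
    (field; apply pow_nonzero; lra).
  apply Rplus_le_compat; [exact Hx|exact Hy].
Qed.

(** The Banach iteration started at 0, which stays in the disc. *)
Lemma half_contraction_fixed_point (N : C -> C) (rho : R) :
  0 <= rho ->
  (forall x, Cmod x <= rho -> Cmod (N x) <= rho) ->
  (forall x x', Cmod x <= rho -> Cmod x' <= rho ->
     Cmod (N x - N x')%C <= / 2 * Cmod (x - x')%C) ->
  exists x, Cmod x <= rho /\ N x = x.
Proof.
  intros Hr Hmap Hlip.
  set (a := fun n : nat => Nat.iter n N (RtoC 0)).
  assert (Ha : forall n, Cmod (a n) <= rho).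
  { induction n; simpl; [now rewrite Cmod_0|now apply Hmap]. }
  assert (Hs : forall n, Cmod (a (S n) - a n)%C <= (2 * rho) / 2 ^ n).
  { induction n as [|n IH].
    - simpl. replace (N 0 - 0)%C with (N 0) by ring.
      pose proof (Ha 1%nat) as H1. simpl in H1. lra.
    - change (a (S (S n))) with (N (a (S n))). change (a (S n)) with (N (a n)) at 2.
      eapply Rle_trans; [apply Hlip; apply Ha|].
      replace (2 * rho / 2 ^ S n) with (/ 2 * (2 * rho / 2 ^ n))
        by (simpl; field; apply pow_nonzero; lra).
      apply Rmult_le_compat_l; [lra|exact IH]. }
  destruct (geometric_limit_C a _ Hs) as (x & Hx).
  set (K := 4 * (2 * rho)) in Hx.
  assert (HK : 0 <= K) by (unfold K; lra).
  assert (Hsmall : forall e, 0 < e -> exists n, K / 2 ^ n < e).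
  { intros e He. destruct (pow_lt_1_zero (/ 2)) with (y := e / (K + 1)) as (n & Hn).
    - rewrite Rabs_pos_eq; lra.
    - apply Rdiv_lt_0_compat; lra.
    - exists n. specialize (Hn n (Nat.le_refl n)).
      rewrite Rabs_pos_eq in Hn by (apply pow_le; lra).
      rewrite pow_inv in Hn.
      assert (0 < / 2 ^ n) by (apply Rinv_0_lt_compat, pow_lt; lra).
      apply (Rmult_lt_compat_r (K + 1)) in Hn; [|lra].
      replace (e / (K + 1) * (K + 1)) with e in Hn by (field; lra).
      unfold Rdiv. nra. }
  assert (Hxr : Cmod x <= rho).
  { apply Rnot_lt_le. intros L.
    destruct (Hsmall (Cmod x - rho)) as (n & Hn); [lra|].
    specialize (Hx n). rewrite Cmod_opp_sub in Hx.
    pose proof (Cmod_sub_triangle x (a n)). specialize (Ha n). lra. }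
  exists x. split; [exact Hxr|].
  apply Ceq_minus, Cmod_eq_0. apply Rle_antisym; [|apply Cmod_ge_0].
  apply Rnot_lt_le. intros L.
  destruct (Hsmall (Cmod (N x - x)%C / 2)) as (n & Hn); [lra|].
  pose proof (Hx n) as X1. pose proof (Hx (S n)) as X2.
  change (a (S n)) with (N (a n)) in X2.
  pose proof (Hlip (a n) x (Ha n) Hxr) as X3.
  assert (X4 : K / 2 ^ S n = / 2 * (K / 2 ^ n))
    by (simpl; field; apply pow_nonzero; lra).
  rewrite X4 in X2.
  pose proof (Cmod_triangle (N (a n) - x)%C (- (N (a n) - N x))%C) as X5.
  replace (N (a n) - x + - (N (a n) - N x))%C with (N x - x)%C in X5 by ring.
  rewrite Cmod_opp in X5. lra.
Qed.

(** * Local inverses, square roots, the exponential *)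

Lemma Cmod_segment (x y : C) (t r : R) :
  0 <= t <= 1 -> Cmod x < r -> Cmod y < r -> Cmod (x + RtoC t * (y - x))%C < r.
Proof.
  intros Ht Hx Hy.
  replace (x + RtoC t * (y - x))%C with (RtoC (1 - t) * x + RtoC t * y)%C
    by (rewrite RtoC_minus; ring).
  eapply Rle_lt_trans; [apply Cmod_triangle|].
  rewrite !Cmod_mult, !Cmod_R, !Rabs_pos_eq by lra.
  destruct (Req_dec t 0) as [->|]; nra.
Qed.

(** The map N(x) = x - Phi(x) / a has derivative 1 - Phi'/a, small near 0, so it
    is a half contraction there.  The fixed point of N + y / a is a preimage of
    y, and |a| |x - x'| / 2 <= |Phi(x) - Phi(x')| makes it unique.  Since
    g' = 1 / Phi'(g), each order of smoothness of g yields the next.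

    The radius r of the disc in which preimages are unique is chosen before d,
    so that several inverse functions can be given the same disc. *)
Lemma inverse_function (rad : R) (Phi : C -> C) (a : C) :
  0 < rad -> Csmooth rad Phi -> Phi 0 = 0 -> cderiv Phi 0 a -> a <> 0 ->
  exists r0, 0 < r0 /\ forall r, 0 < r <= r0 ->
  exists d g, 0 < d /\ Csmooth d g /\ g 0 = 0 /\ cderiv g 0 (/ a)%C /\
    (forall y, Cmod y < d -> Cmod (g y) < r /\ Phi (g y) = y) /\
    (forall x y, Cmod x < r -> Cmod y < d -> Phi x = y -> x = g y) /\
    (forall y, Cmod y < d -> exists l : C, l <> 0 /\ cderiv g y l).
Proof.
  intros Hrad Hs H0 Hda Ha.
  assert (Ha1 : 0 < Cmod a) by now apply Cmod_gt_0.
  destruct (Hs 2%nat) as (f' & F1 & F2).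
  assert (Ef : f' 0 = a).
  { eapply cderiv_unique; [apply F1; now rewrite Cmod_0|exact Hda]. }
  destruct F2 as (f'' & F2 & _).
  destruct (cderiv_continuous f' 0 (f'' 0)) with (eps := Cmod a / 2) as (d0 & Hd0 & B).
  { apply F2. now rewrite Cmod_0. }
  { lra. }
  set (r0 := Rmin d0 rad).
  assert (Hr0 : 0 < r0) by now apply Rmin_glb_lt.
  assert (Bf : forall z, Cmod z < r0 -> Cmod (f' z - a)%C < Cmod a / 2).
  { intros z Hz. specialize (B z). rewrite Cplus_0_l, Ef in B. apply B.
    eapply Rlt_le_trans; [exact Hz|apply Rmin_l]. }
  assert (Bd : forall z, Cmod z < r0 -> cderiv Phi z (f' z)).
  { intros z Hz. apply F1. eapply Rlt_le_trans; [exact Hz|apply Rmin_r]. }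
  assert (Bn : forall z, Cmod z < r0 -> f' z <> 0).
  { intros z Hz E. specialize (Bf z Hz). rewrite E in Bf.
    replace (0 - a)%C with (- a)%C in Bf by ring. rewrite Cmod_opp in Bf. lra. }
  set (N := fun x : C => (x + RtoC (-1) * / a * Phi x)%C).
  assert (HN : forall x x', Cmod x < r0 -> Cmod x' < r0 ->
             Cmod (N x - N x')%C <= / 2 * Cmod (x - x')%C).
  { intros x x' Hx Hx'.
    apply (cderiv_mean_value N
      (fun z => 1 + (0 * Phi z + RtoC (-1) * / a * f' z))%C x' x (/ 2)).
    - intros t Ht. unfold N.
      apply (cderiv_plus (fun x => x)); [apply cderiv_id|].
      apply (cderiv_mult (fun _ => RtoC (-1) * / a)%C Phi); [apply cderiv_const|apply Bd].
      now apply Cmod_segment.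
    - intros t Ht. pose proof (Bf _ (Cmod_segment x' x t r0 Ht Hx' Hx)) as B1.
      set (z := (x' + RtoC t * (x - x'))%C) in *.
      replace (1 + (0 * Phi z + RtoC (-1) * / a * f' z))%C
        with (- (/ a * (f' z - a)))%C by (now field).
      rewrite Cmod_opp, Cmod_mult, Cmod_inv by assumption.
      apply Rmult_le_reg_l with (Cmod a); [assumption|].
      rewrite <- Rmult_assoc, Rinv_r by lra. lra. }
  assert (Hlow : forall x x', Cmod x < r0 -> Cmod x' < r0 ->
             Cmod a / 2 * Cmod (x - x')%C <= Cmod (Phi x - Phi x')%C).
  { intros x x' Hx Hx'. specialize (HN x x' Hx Hx').
    pose proof (Cmod_triangle (N x - N x')%C (/ a * (Phi x - Phi x'))%C) as Tr.
    replace (N x - N x' + / a * (Phi x - Phi x'))%C with (x - x')%C in Tr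
      by (unfold N; now field).
    rewrite Cmod_mult, Cmod_inv in Tr by assumption.
    apply Rmult_le_reg_l with (/ Cmod a); [now apply Rinv_0_lt_compat|].
    replace (/ Cmod a * (Cmod a / 2 * Cmod (x - x')%C)) with (Cmod (x - x')%C / 2)
      by (field; lra). lra. }
  exists r0. split; [exact Hr0|]. intros r Hr.
  (* |N(x) + y / a| <= |x| / 2 + r / 4 maps the disc of radius r / 2 to itself *)
  set (d := r * Cmod a / 4).
  assert (Hd : 0 < d) by (unfold d; apply Rdiv_lt_0_compat; nra).
  assert (Hex : forall y, exists x, Cmod y < d -> Cmod x < r /\ Phi x = y).
  { intros y. destruct (Rlt_dec (Cmod y) d) as [Hy|Hy]; [|now exists 0].
    destruct (half_contraction_fixed_point (fun x => N x + / a * y)%C (r / 2))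
      as (x & Hx & E).
    - lra.
    - intros x Hx. eapply Rle_trans; [apply Cmod_triangle|].
      rewrite Cmod_mult, Cmod_inv by assumption.
      assert (X1 : Cmod (N x) <= / 2 * Cmod x).
      { pose proof (HN x 0) as X. rewrite Cmod_0 in X.
        replace (N x - N 0)%C with (N x) in X by (unfold N; rewrite H0; ring).
        replace (x - 0)%C with x in X by ring. apply X; lra. }
      assert (X2 : / Cmod a * Cmod y <= r / 4).
      { apply Rmult_le_reg_l with (Cmod a); [assumption|].
        rewrite <- Rmult_assoc, Rinv_r by lra. unfold d in Hy. lra. }
      lra.
    - intros x x' Hx Hx'.
      replace (N x + / a * y - (N x' + / a * y))%C with (N x - N x')%C by ring.
      apply HN; lra.
    - exists x. intros _. split; [lra|].
      unfold N in E.
      replace (Phi x) with (- a * ((x + RtoC (-1) * / a * Phi x + / a * y) - x) + y)%C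
        by (now field).
      rewrite E. ring. }
  set (g := fun y => proj1_sig (constructive_indefinite_description _ (Hex y))).
  assert (Hg : forall y, Cmod y < d -> Cmod (g y) < r /\ Phi (g y) = y).
  { intros y. unfold g. destruct (constructive_indefinite_description _ (Hex y)) as (x & Hx).
    exact Hx. }
  assert (Huniq : forall x y, Cmod x < r -> Cmod y < d -> Phi x = y -> x = g y).
  { intros x y Hx Hy E. destruct (Hg y Hy) as (G1 & G2).
    apply Ceq_minus, Cmod_eq_0.
    pose proof (Hlow x (g y)) as L. rewrite G2, E in L.
    replace (y - y)%C with (RtoC 0) in L by ring. rewrite Cmod_0 in L.
    assert (Cmod a / 2 * Cmod (x - g y)%C <= 0) by (apply L; lra).
    pose proof (Cmod_ge_0 (x - g y)%C). nra. }
  assert (Hgd : forall y, Cmod y < d -> cderiv g y (/ f' (g y))%C).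
  { intros y Hy. destruct (Hg y Hy) as (G1 & G2).
    assert (Hin : forall h, Cmod h < d - Cmod y -> Cmod (y + h)%C < d).
    { intros h Hh. pose proof (Cmod_triangle y h). lra. }
    apply (cderiv_inverse Phi g y (f' (g y)) (Cmod a / 2) (d - Cmod y)); try lra.
    - intros h Hh. apply (Hg _ (Hin h Hh)).
    - intros h Hh. destruct (Hg _ (Hin h Hh)) as (G3 & G4).
      eapply Rle_trans; [apply Hlow; lra|]. rewrite G2, G4.
      apply Req_le. f_equal. ring.
    - apply Bn. lra.
    - apply Bd. lra. }
  assert (Hg0 : g 0 = 0).
  { symmetry. apply Huniq; rewrite ?Cmod_0; auto; lra. }
  exists d, g. repeat match goal with |- _ /\ _ => split end; auto.
  - intros n. induction n as [|n IH]; [exact I|].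
    destruct (Hs (S n)) as (fn & N1 & N2).
    exists (fun y => / fn (g y))%C.
    assert (En : forall y, Cmod y < d -> fn (g y) = f' (g y)).
    { intros y Hy. destruct (Hg y Hy) as (G1 & _).
      eapply cderiv_unique; [apply N1|apply F1];
        (eapply Rlt_le_trans; [|apply (Rmin_r d0 rad)]); fold r0; lra. }
    split.
    + intros y Hy. rewrite En by assumption. auto.
    + apply Cdiff_inv.
      * intros y Hy. rewrite En by assumption. apply Bn.
        destruct (Hg y Hy). lra.
      * apply (Cdiff_comp n d rad); auto.
        intros y Hy. destruct (Hg y Hy) as (G1 & _).
        eapply Rlt_le_trans; [|apply (Rmin_r d0 rad)]. fold r0. lra.
  - pose proof (Hgd 0) as G. rewrite Hg0, Ef in G. apply G. now rewrite Cmod_0.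
  - intros y Hy. exists (/ f' (g y))%C. split; [|auto].
    assert (Hn : f' (g y) <> 0) by (apply Bn; destruct (Hg y Hy); lra).
    intros E. apply (f_equal (Cmult (f' (g y)))) in E.
    rewrite Cinv_r, Cmult_0_r in E by assumption. now apply RtoC_inj, R1_neq_R0 in E.
Qed.

(** Writing S = s + x, the equation S^2 = P becomes 2 s x + x^2 = P - s^2,
    whose left side is locally invertible as s <> 0. *)
Lemma smooth_sqrt (rad : R) (P : C -> C) (s : C) :
  0 < rad -> Csmooth rad P -> P 0 = (s * s)%C -> s <> 0 ->
  exists r S, 0 < r <= rad /\ Csmooth r S /\ S 0 = s /\
    forall z, Cmod z < r -> (S z * S z)%C = P z.
Proof.
  intros Hrad HP H0 Hs.
  set (Phi := fun x : C => ((2 * s) * x + x * x)%C).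
  destruct (inverse_function 1 Phi (2 * s)%C) as (r0 & Hr0 & H).
  - lra.
  - intros n. repeat first [apply Cdiff_plus | apply Cdiff_mult | apply Cdiff_id | apply Cdiff_const].
  - unfold Phi. ring.
  - unfold Phi. eapply cderiv_eq.
    + apply (cderiv_plus (fun x => 2 * s * x)%C (fun x => x * x)%C).
      * apply (cderiv_mult (fun _ => 2 * s)%C (fun x => x)); [apply cderiv_const|apply cderiv_id].
      * apply (cderiv_mult (fun x => x) (fun x => x)); apply cderiv_id.
    + ring.
  - apply Cmult_neq_0; [|exact Hs]. intros E. apply RtoC_inj in E. lra.
  - destruct (H r0) as (d & g & Hd & Gs & G0 & _ & G1 & _); [lra|].
    destruct (Csmooth_continuous_0 rad P Hrad HP d Hd) as (r & Hr & B).
    exists r, (fun z => s + g (P z + - (s * s)))%C.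
    rewrite H0 in B.
    repeat match goal with |- _ /\ _ => split end; try lra.
    + intros n. apply Cdiff_plus; [apply Cdiff_const|].
      apply (Cdiff_comp n r d g (fun z => P z + - (s * s))%C); auto.
      * apply Cdiff_plus; [|apply Cdiff_const]. eapply Cdiff_shrink; [|apply HP]. lra.
    + rewrite H0. replace (s * s + - (s * s))%C with (RtoC 0) by ring.
      rewrite G0. ring.
    + intros z Hz. specialize (B z Hz). destruct (G1 _ B) as (_ & E).
      unfold Phi in E. change (P z - s * s)%C with (P z + - (s * s))%C in E.
      set (x := g (P z + - (s * s))%C) in *.
      replace ((s + x) * (s + x))%C with (s * s + (2 * s * x + x * x))%C by ring.
      rewrite E. ring.
Qed.

Definition Cexp (z : C) : C := (exp (Re z) * cos (Im z), exp (Re z) * sin (Im z)).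

Lemma Cexp_plus (z w : C) : Cexp (z + w)%C = (Cexp z * Cexp w)%C.
Proof.
  destruct z as (a, b), w as (x, y). unfold Cexp, Cplus, Cmult. simpl.
  rewrite exp_plus, cos_plus, sin_plus. f_equal; ring.
Qed.

Lemma Cexp_0 : Cexp 0 = 1.
Proof. unfold Cexp. simpl. rewrite exp_0, cos_0, sin_0. unfold RtoC. f_equal; ring. Qed.

Lemma Cexp_neq_0 z : Cexp z <> 0.
Proof.
  intros E. pose proof (Cexp_plus z (- z)%C) as H.
  rewrite E in H. replace (z + - z)%C with (RtoC 0) in H by ring.
  rewrite Cexp_0, Cmult_0_l in H. now apply RtoC_inj, R1_neq_R0 in H.
Qed.

Lemma is_derive_bound_0 (f : R -> R) (l : R) :
  is_derive f 0 l -> forall eps, 0 < eps -> exists d, 0 < d /\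
  forall x, Rabs x < d -> Rabs (f x - f 0 - x * l) <= eps * Rabs x.
Proof.
  intros [_ H] eps He.
  destruct (H 0 (fun P HP => HP) (mkposreal eps He)) as [d Hd].
  exists d; split; [apply cond_pos|]. intros x Hx.
  assert (Hb : ball 0 d x).
  { change (Rabs (x - 0) < d). now rewrite Rminus_0_r. }
  specialize (Hd x Hb).
  change (Rabs (f x - f 0 - (x - 0) * l) <= eps * Rabs (x - 0)) in Hd.
  now rewrite Rminus_0_r in Hd.
Qed.

(** The functional equation reduces the claim to z = 0, where it follows from
    the derivatives of exp, cos and sin at 0. *)
Lemma cderiv_Cexp z : cderiv Cexp z (Cexp z).
Proof.
  assert (D0 : cderiv Cexp 0 1).
  { apply cderiv_bound. intros eps He.
    set (e := Rmin (eps / 8) (1 / 2)).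
    assert (He0 : 0 < e) by (apply Rmin_glb_lt; lra).
    assert (He1 : e <= eps / 8) by apply Rmin_l.
    assert (He2 : e <= 1 / 2) by apply Rmin_r.
    clearbody e.
    destruct (is_derive_bound_0 exp 1) with (eps := e) as (d1 & Hd1 & B1); auto.
    { auto_derive; auto. rewrite exp_0. ring. }
    destruct (is_derive_bound_0 cos 0) with (eps := e) as (d2 & Hd2 & B2); auto.
    { auto_derive; auto. rewrite sin_0. ring. }
    destruct (is_derive_bound_0 sin 1) with (eps := e) as (d3 & Hd3 & B3); auto.
    { auto_derive; auto. rewrite cos_0. ring. }
    exists (Rmin e (Rmin d1 (Rmin d2 d3))). split.
    { repeat apply Rmin_glb_lt; assumption. }
    intros h Hh.
    assert (Hh1 : Cmod h < e /\ Cmod h < d1 /\ Cmod h < d2 /\ Cmod h < d3).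
    { pose proof (Rmin_l e (Rmin d1 (Rmin d2 d3))). pose proof (Rmin_r e (Rmin d1 (Rmin d2 d3))).
      pose proof (Rmin_l d1 (Rmin d2 d3)). pose proof (Rmin_r d1 (Rmin d2 d3)).
      pose proof (Rmin_l d2 d3). pose proof (Rmin_r d2 d3). lra. }
    destruct Hh1 as (h0 & h1 & h2 & h3).
    pose proof (re_le_Cmod h) as Hre. pose proof (Im_le_Cmod h) as Him.
    pose proof (Cmod_ge_0 h) as Hc.
    specialize (B1 (Re h)). specialize (B2 (Im h)). specialize (B3 (Im h)).
    rewrite Cplus_0_l, Cexp_0.
    eapply Rle_trans; [apply Cmod_le_Re_Im|].
    set (x := Re h) in *. set (y := Im h) in *. set (m := Cmod h) in *.
    rewrite exp_0 in B1. rewrite cos_0 in B2. rewrite sin_0 in B3.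
    assert (C1 : Rabs (exp x - 1 - x * 1) <= e * m) by (eapply Rle_trans; [apply B1; lra|nra]).
    assert (C2 : Rabs (cos y - 1 - y * 0) <= e * m) by (eapply Rle_trans; [apply B2; lra|nra]).
    assert (C3 : Rabs (sin y - 0 - y * 1) <= e * m) by (eapply Rle_trans; [apply B3; lra|nra]).
    replace (Re (Cexp h - 1 - h * 1)%C) with (exp x * (cos y - 1 - y * 0) + (exp x - 1 - x * 1))
      by (unfold Cexp, x, y; destruct h; simpl; ring).
    replace (Im (Cexp h - 1 - h * 1)%C)
      with (exp x * (sin y - 0 - y * 1) + y * ((exp x - 1 - x * 1) + x))
      by (unfold Cexp, x, y; destruct h; simpl; ring).
    assert (Ex : Rabs (exp x) <= 2).
    { rewrite Rabs_pos_eq by (left; apply exp_pos).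
      apply Rabs_le_between in C1. apply Rabs_le_between in Hre. nra. }
    assert (Ey : Rabs (y * ((exp x - 1 - x * 1) + x)) <= m * (2 * e)).
    { rewrite Rabs_mult. apply Rmult_le_compat; try apply Rabs_pos; auto.
      eapply Rle_trans; [apply Rabs_triang|]. nra. }
    assert (Ez : forall u, Rabs u <= e * m -> Rabs (exp x * u) <= 2 * (e * m)).
    { intros u Hu. rewrite Rabs_mult. apply Rmult_le_compat; auto; apply Rabs_pos. }
    pose proof (Ez _ C2). pose proof (Ez _ C3).
    pose proof (Rabs_triang (exp x * (cos y - 1 - y * 0)) (exp x - 1 - x * 1)).
    pose proof (Rabs_triang (exp x * (sin y - 0 - y * 1)) (y * ((exp x - 1 - x * 1) + x))).
    nra. }
  apply cderiv_bound. intros eps He.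
  assert (Hm : 0 < Cmod (Cexp z)) by apply Cmod_gt_0, Cexp_neq_0.
  destruct (proj1 (cderiv_bound _ _ _) D0 (eps / Cmod (Cexp z))) as (d & Hd & B).
  { now apply Rdiv_lt_0_compat. }
  exists d. split; [exact Hd|]. intros h Hh. specialize (B h Hh).
  rewrite Cplus_0_l, Cexp_0 in B. rewrite Cexp_plus.
  replace (Cexp z * Cexp h - Cexp z - h * Cexp z)%C
    with (Cexp z * (Cexp h - 1 - h * 1))%C by ring.
  rewrite Cmod_mult.
  apply (Rmult_le_compat_l (Cmod (Cexp z))) in B; [|lra].
  replace (Cmod (Cexp z) * (eps / Cmod (Cexp z) * Cmod h)) with (eps * Cmod h) in B
    by (field; lra). exact B.
Qed.

Lemma cderiv_Cexp_scal (a z : C) :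
  cderiv (fun x => Cexp (a * x)%C) z (a * Cexp (a * z))%C.
Proof.
  eapply cderiv_eq.
  - apply (cderiv_comp Cexp (fun x => a * x)%C); [apply cderiv_Cexp|].
    apply (cderiv_mult (fun _ => a) (fun x => x)); [apply cderiv_const|apply cderiv_id].
  - cbv beta. ring.
Qed.

Lemma Cdiff_Cexp_scal (a : C) n r : Cdiff n r (fun z => Cexp (a * z)%C).
Proof.
  induction n as [|n IH]; [exact I|].
  exists (fun z => a * Cexp (a * z))%C. split.
  - intros z _. apply cderiv_Cexp_scal.
  - apply Cdiff_mult; [apply Cdiff_const|exact IH].
Qed.

Lemma cderiv_Re_real (G : C -> C) (t : R) (l : C) :
  cderiv G t l -> is_derive (fun s : R => Re (G s)) t (Re l).
Proof.
  intros H.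
  pose proof (cderiv_Re_line G 0 1 l t) as L.
  replace (0 + t * 1)%C with (RtoC t) in L by ring.
  replace (1 * l)%C with l in L by ring.
  eapply is_derive_ext; [|exact (L H)].
  intros s. cbv beta. do 2 f_equal. ring.
Qed.

Lemma cderiv_Im_real (G : C -> C) (t : R) (l : C) :
  cderiv G t l -> is_derive (fun s : R => Im (G s)) t (Im l).
Proof.
  intros H.
  pose proof (cderiv_Re_real (fun z => - Ci * G z)%C t (0 * G t + - Ci * l)%C) as L.
  replace (Re (0 * G t + - Ci * l)%C) with (Im l) in L
    by (destruct l, (G t); simpl; ring).
  eapply is_derive_ext; [|apply L].
  - intros s. cbv beta. destruct (G s); simpl; ring.
  - apply (cderiv_mult (fun _ => - Ci)%C G); [apply cderiv_const|exact H].
Qed.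

(** Iterated derivatives add the outermost derivative last; this lemma takes
    off the innermost one, as an induction along Cdiff requires. *)
Lemma ex_derive_n_of_derivative (f f' : R -> R) (n : nat) (d t : R) :
  (forall s, Rabs s < d -> is_derive f s (f' s)) -> Rabs t < d ->
  ex_derive_n f' n t -> ex_derive_n f (S n) t.
Proof.
  intros Hf Ht Hn.
  assert (Hloc : forall s, Rabs s < d -> locally s (fun u => f' u = Derive f u)).
  { intros s Hs. assert (Hp : 0 < d - Rabs s) by lra.
    exists (mkposreal _ Hp). intros u Hu. change (Rabs (u - s) < d - Rabs s) in Hu.
    symmetry. apply is_derive_unique, Hf.
    replace u with (s + (u - s)) by ring.
    pose proof (Rabs_triang s (u - s)). lra. }
  assert (Hd : locally t (fun s => Rabs s < d)).
  { assert (Hp : 0 < d - Rabs t) by lra.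
    exists (mkposreal _ Hp). intros u Hu. change (Rabs (u - t) < d - Rabs t) in Hu.
    replace u with (t + (u - t)) by ring.
    pose proof (Rabs_triang t (u - t)). lra. }
  destruct n as [|n]; [exists (f' t); now apply Hf|].
  simpl in Hn |- *.
  apply ex_derive_ext_loc with (Derive_n f' n); [|exact Hn].
  apply filter_imp with (2 := Hd). intros s Hs.
  rewrite (Derive_n_ext_loc f' (Derive f) n s) by (now apply Hloc).
  replace (Derive (Derive_n f n) s) with (Derive_n f (S n) s) by reflexivity.
  replace (S n) with (n + 1)%nat by lia.
  exact (Derive_n_comp f n 1 s).
Qed.

Lemma Cdiff_ex_derive_n n : forall (d : R) (G : C -> C), Cdiff n d G ->
  forall t : R, Rabs t < d ->
  ex_derive_n (fun s : R => Re (G s)) n t /\ ex_derive_n (fun s : R => Im (G s)) n t.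
Proof.
  induction n as [|n IH]; intros d G HG t Ht; [split; exact I|].
  destruct HG as (G' & H1 & H2). destruct (IH d G' H2 t Ht) as (I1 & I2).
  split.
  - apply ex_derive_n_of_derivative with (f' := fun s : R => Re (G' s)) (d := d); auto.
    intros s Hs. apply cderiv_Re_real, H1. now rewrite Cmod_R.
  - apply ex_derive_n_of_derivative with (f' := fun s : R => Im (G' s)) (d := d); auto.
    intros s Hs. apply cderiv_Im_real, H1. now rewrite Cmod_R.
Qed.

(** * Power series *)

(** Summation of real series is a total function, hence the componentwise sum. *)
Definition CSeries (a : nat -> C) : C :=
  (Series (fun n => Re (a n)), Series (fun n => Im (a n))).

Lemma dominated_Re (a : nat -> C) (M : nat -> R) :
  (forall n, Cmod (a n) <= M n) -> ex_series M -> ex_series (fun n => Re (a n)).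
Proof.
  intros H HM. apply (ex_series_le (V := R_CompleteNormedModule)) with (2 := HM).
  intros n. eapply Rle_trans; [|apply H]. apply (re_le_Cmod (a n)).
Qed.

Lemma dominated_Im (a : nat -> C) (M : nat -> R) :
  (forall n, Cmod (a n) <= M n) -> ex_series M -> ex_series (fun n => Im (a n)).
Proof.
  intros H HM. apply (ex_series_le (V := R_CompleteNormedModule)) with (2 := HM).
  intros n. eapply Rle_trans; [|apply H]. apply (Im_le_Cmod (a n)).
Qed.

Lemma Series_dominated (u M : nat -> R) :
  (forall n, Rabs (u n) <= M n) -> ex_series M -> Rabs (Series u) <= Series M.
Proof.
  intros H HM. eapply Rle_trans.
  - apply Series_Rabs. apply (ex_series_le (V := R_CompleteNormedModule)) with (2 := HM).
    intros n. change (norm (Rabs (u n))) with (Rabs (Rabs (u n))). rewrite Rabs_Rabsolu. apply H.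
  - apply Series_le; [|exact HM]. intros n. split; [apply Rabs_pos|apply H].
Qed.

Lemma CSeries_bound (a : nat -> C) (M : nat -> R) :
  (forall n, Cmod (a n) <= M n) -> ex_series M -> Cmod (CSeries a) <= 2 * Series M.
Proof.
  intros H HM. eapply Rle_trans; [apply Cmod_le_Re_Im|]. simpl.
  replace (2 * Series M) with (Series M + Series M) by ring.
  apply Rplus_le_compat; apply Series_dominated; auto; intros n;
    (eapply Rle_trans; [|apply H]); [apply re_le_Cmod|apply Im_le_Cmod].
Qed.

(** Taken with a_n and b_n the terms of a power series at z + h and at z, and
    c_n the terms of the differentiated series, this is the remainder that
    complex differentiability has to bound. *)
Lemma CSeries_linear_remainder (a b c : nat -> C) (M : nat -> R) (h : C) :
  (forall n, Cmod (a n) <= M n) -> (forall n, Cmod (b n) <= M n) ->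
  (forall n, Cmod (c n) <= M n) -> ex_series M ->
  (CSeries a - CSeries b - h * CSeries c)%C =
  CSeries (fun n => a n - b n - h * c n)%C.
Proof.
  intros Ha Hb Hc HM.
  pose proof (dominated_Re a M Ha HM) as a1. pose proof (dominated_Im a M Ha HM) as a2.
  pose proof (dominated_Re b M Hb HM) as b1. pose proof (dominated_Im b M Hb HM) as b2.
  pose proof (dominated_Re c M Hc HM) as c1. pose proof (dominated_Im c M Hc HM) as c2.
  destruct h as (x, y).
  assert (L : forall (u v w1 w2 : nat -> R) (p q : R),
    ex_series u -> ex_series v -> ex_series w1 -> ex_series w2 ->
    Series (fun n => u n - v n - (p * w1 n + q * w2 n))
    = Series u - Series v - (p * Series w1 + q * Series w2)).
  { intros u v w1 w2 p q Hu Hv H1 H2.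
    assert (S1 : ex_series (fun n => p * w1 n)) by exact (ex_series_scal_l p w1 H1).
    assert (S2 : ex_series (fun n => q * w2 n)) by exact (ex_series_scal_l q w2 H2).
    assert (S12 : ex_series (fun n => p * w1 n + q * w2 n))
      by exact (ex_series_plus _ _ S1 S2).
    assert (Suv : ex_series (fun n => u n - v n)) by exact (ex_series_minus _ _ Hu Hv).
    rewrite (Series_minus (fun n => u n - v n) _ Suv S12), (Series_minus u v Hu Hv).
    rewrite (Series_plus (fun n => p * w1 n) (fun n => q * w2 n) S1 S2).
    now rewrite !Series_scal_l. }
  apply injective_projections.
  - change (Series (fun n => Re (a n)) + - Series (fun n => Re (b n))
      + - (x * Series (fun n => Re (c n)) - y * Series (fun n => Im (c n)))
      = Series (fun n => Re (a n - b n - (x, y) * c n)%C)).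
    transitivity (Series (fun n => Re (a n) - Re (b n) - (x * Re (c n) + - y * Im (c n)))).
    + rewrite L by assumption. ring.
    + apply Series_ext. intros n. destruct (a n), (b n), (c n). simpl. ring.
  - change (Series (fun n => Im (a n)) + - Series (fun n => Im (b n))
      + - (x * Series (fun n => Im (c n)) + y * Series (fun n => Re (c n)))
      = Series (fun n => Im (a n - b n - (x, y) * c n)%C)).
    transitivity (Series (fun n => Im (a n) - Im (b n) - (x * Im (c n) + y * Re (c n)))).
    + rewrite L by assumption. ring.
    + apply Series_ext. intros n. destruct (a n), (b n), (c n). simpl. ring.
Qed.

(** The stronger bound 1 - s^n passes through the induction. *)
Lemma n_pow_bounded (s : R) (n : nat) : 0 <= s < 1 -> (1 - s) * (INR n * s ^ n) <= 1.
Proof.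
  intros Hs.
  assert (H : (1 - s) * (INR n * s ^ n) <= 1 - s ^ n).
  { induction n as [|n IH]; [simpl; lra|].
    rewrite S_INR. simpl.
    assert (0 <= s ^ n) by (apply pow_le; lra).
    assert (s ^ n <= 1).
    { rewrite <- (pow1 n). apply pow_incr. lra. }
    apply (Rmult_le_compat_l s) in IH; [|lra].
    assert (0 <= (1 - s) * (1 - s * s ^ n)) by (apply Rmult_le_pos; nra).
    nra. }
  assert (0 <= s ^ n) by (apply pow_le; lra). lra.
Qed.

(** Some s < 1 has x <= s^3; two of the three factors s^n absorb n^2, and the
    third is summable. *)
Lemma ex_series_poly_geom (x : R) : 0 <= x < 1 ->
  ex_series (fun n => (1 + INR n * INR n) * x ^ n).
Proof.
  intros Hx. set (s := 1 - (1 - x) / 3).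
  assert (Hs : 0 <= s < 1) by (unfold s; lra).
  assert (Hxs : x <= s * s * s).
  { (* Bernoulli: s^3 - x = t^2 (3 - t) with t = 1 - s *)
    assert (0 <= (1 - s) * (1 - s) * (3 - (1 - s)))
      by (apply Rmult_le_pos; [apply Rmult_le_pos|]; lra).
    unfold s in *. nra. }
  assert (Hk : 0 < / (1 - s)) by (apply Rinv_0_lt_compat; lra).
  set (k := / (1 - s)) in *.
  apply (ex_series_le (V := R_CompleteNormedModule)) with (b := fun n => (1 + k * k) * s ^ n).
  - intros n.
    assert (P : 0 <= s ^ n <= 1).
    { split; [apply pow_le; lra|]. rewrite <- (pow1 n). apply pow_incr. lra. }
    assert (Q : INR n * s ^ n <= k).
    { apply Rmult_le_reg_l with (1 - s); [lra|].
      unfold k at 1. rewrite Rinv_r by lra. now apply n_pow_bounded. }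
    assert (X : 0 <= x ^ n <= s ^ n * s ^ n * s ^ n).
    { split; [apply pow_le; lra|]. rewrite <- !Rpow_mult_distr. apply pow_incr. lra. }
    pose proof (pos_INR n) as N0.
    change (Rabs ((1 + INR n * INR n) * x ^ n) <= (1 + k * k) * s ^ n).
    rewrite Rabs_pos_eq by (apply Rmult_le_pos; nra).
    eapply Rle_trans.
    { apply Rmult_le_compat_l; [nra|]. apply X. }
    replace ((1 + INR n * INR n) * (s ^ n * s ^ n * s ^ n))
      with ((s ^ n * s ^ n + (INR n * s ^ n) * (INR n * s ^ n)) * s ^ n) by ring.
    apply Rmult_le_compat_r; [lra|].
    assert (0 <= INR n * s ^ n) by nra. nra.
  - apply (ex_series_scal_l (1 + k * k) (fun n => s ^ n)). apply ex_series_geom.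
    rewrite Rabs_pos_eq; lra.
Qed.

Definition cps (b : nat -> C) (z : C) : C := CSeries (fun n => b n * z ^ n)%C.

(** The constant A may depend on r, so the same B works for the differentiated
    series. *)
Definition radius_ge (b : nat -> C) (B : R) : Prop :=
  forall r, 0 <= r < B -> exists A, forall n, Cmod (b n) * r ^ n <= A.

Definition dcoef (b : nat -> C) (n : nat) : C := (RtoC (INR (S n)) * b (S n))%C.

(** The factor n + 1 is absorbed by (r / r')^n for some r' between r and B. *)
Lemma radius_ge_dcoef b B : radius_ge b B -> radius_ge (dcoef b) B.
Proof.
  intros H r Hr. set (r' := (r + B) / 2).
  assert (Hr' : 0 < r' < B /\ r < r') by (unfold r'; lra).
  destruct (H r') as (A & HA); [lra|].
  set (s := r / r').
  assert (Hs : 0 <= s < 1).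
  { unfold s. split; [apply Rdiv_le_0_compat; lra|].
    apply Rmult_lt_reg_r with r'; [lra|]. unfold Rdiv.
    rewrite Rmult_assoc, Rinv_l; lra. }
  assert (Hk : 0 < / (1 - s)) by (apply Rinv_0_lt_compat; lra).
  exists (A / r' * (/ (1 - s) + 1)). intros n.
  unfold dcoef. rewrite Cmod_mult, Cmod_R, (Rabs_pos_eq (INR (S n))) by apply pos_INR.
  assert (E : r = s * r') by (unfold s; field; lra).
  rewrite E, Rpow_mult_distr.
  replace (INR (S n) * Cmod (b (S n)) * (s ^ n * r' ^ n))
    with (Cmod (b (S n)) * r' ^ S n / r' * (INR (S n) * s ^ n))
    by (simpl pow; field; lra).
  assert (P : 0 <= s ^ n <= 1).
  { split; [apply pow_le; lra|]. rewrite <- (pow1 n). apply pow_incr. lra. }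
  apply Rmult_le_compat.
  - apply Rdiv_le_0_compat; [|lra]. apply Rmult_le_pos; [apply Cmod_ge_0|apply pow_le; lra].
  - apply Rmult_le_pos; [apply pos_INR|lra].
  - apply Rmult_le_compat_r; [left; apply Rinv_0_lt_compat; lra|]. apply HA.
  - rewrite S_INR.
    assert (INR n * s ^ n <= / (1 - s)).
    { apply Rmult_le_reg_l with (1 - s); [lra|].
      rewrite Rinv_r by lra. now apply n_pow_bounded. }
    lra.
Qed.

(** The remainders t_n satisfy t_(n+1) = (z + h) t_n + n h^2 z^(n-1).  At n = 0
    the factor INR n cancels the spurious power z ^ pred 0. *)
Lemma pow_remainder (z h : C) (r : R) (n : nat) :
  0 < r -> Cmod z <= r -> Cmod (z + h)%C <= r ->
  Cmod ((z + h) ^ n - z ^ n - h * (INR n * z ^ pred n))%C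
  <= Cmod h * Cmod h * (INR n * INR n * r ^ n / (r * r)).
Proof.
  intros Hr Hz Hzh. pose proof (Cmod_ge_0 h) as Hh.
  induction n as [|n IH].
  - simpl. replace (1 - 1 - h * (0 * 1))%C with (RtoC 0) by ring.
    rewrite Cmod_0. apply Req_le. field. lra.
  - assert (E : ((z + h) ^ S n - z ^ S n - h * (INR (S n) * z ^ pred (S n)))%C =
      ((z + h) * ((z + h) ^ n - z ^ n - h * (INR n * z ^ pred n))
        + h * h * (INR n * z ^ pred n))%C).
    { rewrite S_INR, RtoC_plus, !Cpow_S. destruct n as [|n]; [simpl; ring|].
      simpl pred. rewrite !Cpow_S. ring. }
    rewrite E. eapply Rle_trans; [apply Cmod_triangle|].
    rewrite !Cmod_mult, Cmod_R, Rabs_pos_eq by apply pos_INR.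
    assert (B1 : Cmod (z ^ pred n)%C * INR n <= r ^ n / r * INR n).
    { destruct n as [|n]; [simpl; lra|].
      apply Rmult_le_compat_r; [apply pos_INR|].
      simpl pred. rewrite Cmod_pow.
      replace (r ^ S n / r) with (r ^ n) by (simpl; field; lra).
      apply pow_incr. split; [apply Cmod_ge_0|exact Hz]. }
    eapply Rle_trans.
    { apply Rplus_le_compat.
      - apply Rmult_le_compat; [apply Cmod_ge_0|apply Cmod_ge_0|exact Hzh|exact IH].
      - apply Rmult_le_compat_l; [nra|]. rewrite (Rmult_comm (INR n)). exact B1. }
    replace (r * (Cmod h * Cmod h * (INR n * INR n * r ^ n / (r * r))) +
             Cmod h * Cmod h * (r ^ n / r * INR n))
      with (Cmod h * Cmod h * (r ^ n / r * (INR n * INR n + INR n))) by (field; lra).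
    apply Rmult_le_compat_l; [nra|].
    replace (INR (S n) * INR (S n) * r ^ S n / (r * r))
      with (r ^ n / r * (INR (S n) * INR (S n))) by (simpl pow; field; lra).
    apply Rmult_le_compat_l.
    + apply Rdiv_le_0_compat; [apply pow_le; lra|lra].
    + rewrite S_INR. pose proof (pos_INR n). nra.
Qed.

(** Termwise differentiation: the remainder of each monomial is at most
    |h|^2 n^2 r^n / r^2, and these bounds are summable against the coefficients
    for some r with |z| < r < B. *)
Lemma cderiv_cps b B z : radius_ge b B -> Cmod z < B ->
  cderiv (cps b) z (cps (dcoef b) z).
Proof.
  intros Hb Hz. pose proof (Cmod_ge_0 z) as Hz0.
  set (r := Cmod z + (B - Cmod z) / 3). set (r' := Cmod z + 2 * (B - Cmod z) / 3).
  assert (Hr : Cmod z < r /\ 0 < r /\ r < r' /\ r' < B) by (unfold r, r'; lra).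
  destruct Hr as (R1 & R2 & R3 & R4).
  destruct (Hb r') as (A & HA); [lra|].
  set (x := r / r').
  assert (Hx : 0 <= x < 1).
  { unfold x. split; [apply Rdiv_le_0_compat; lra|].
    apply Rmult_lt_reg_r with r'; [lra|]. unfold Rdiv. rewrite Rmult_assoc, Rinv_l; lra. }
  assert (Er : r = x * r') by (unfold x; field; lra).
  assert (HA0 : 0 <= A).
  { eapply Rle_trans; [|apply (HA O)]. apply Rmult_le_pos; [apply Cmod_ge_0|simpl; lra]. }
  assert (Hbr : forall n, Cmod (b n) * r ^ n <= A * x ^ n).
  { intros n. rewrite Er, Rpow_mult_distr, (Rmult_comm (x ^ n)), <- Rmult_assoc.
    apply Rmult_le_compat_r; [apply pow_le; lra|apply HA]. }
  set (K := A * (1 + / r + / (r * r))).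
  assert (Hir : 0 < / r) by now apply Rinv_0_lt_compat.
  assert (Hirr : 0 < / (r * r)) by (apply Rinv_0_lt_compat; nra).
  set (M := fun n : nat => K * ((1 + INR n * INR n) * x ^ n)).
  assert (HM : ex_series M)
    by (apply (ex_series_scal_l K (fun n => (1 + INR n * INR n) * x ^ n));
        now apply ex_series_poly_geom).
  assert (HxN : forall n, 0 <= x ^ n) by (intros; apply pow_le; lra).
  assert (HN : forall n, INR n <= 1 + INR n * INR n).
  { intros n. pose proof (pos_INR n). nra. }
  (* M dominates the three series whose terms enter the remainder *)
  assert (Hdom : forall n c, 0 <= c -> c <= (1 + / r + / (r * r)) * (1 + INR n * INR n) ->
             Cmod (b n) * r ^ n * c <= M n).
  { intros n c Hc0 Hc. unfold M, K.
    eapply Rle_trans.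
    { apply Rmult_le_compat; [| exact Hc0 | apply Hbr | exact Hc].
      apply Rmult_le_pos; [apply Cmod_ge_0|apply pow_le; lra]. }
    apply Req_le. ring. }
  assert (Dpow : forall w n, Cmod w <= r -> Cmod (b n * w ^ n)%C <= M n).
  { intros w n Hw. rewrite Cmod_mult, Cmod_pow.
    eapply Rle_trans; [|apply (Hdom n 1); [lra|]].
    - rewrite Rmult_1_r. apply Rmult_le_compat_l; [apply Cmod_ge_0|].
      apply pow_incr. split; [apply Cmod_ge_0|exact Hw].
    - pose proof (pos_INR n). nra. }
  assert (Dder : forall n, Cmod (b n * (INR n * z ^ pred n))%C <= M n).
  { intros n. rewrite !Cmod_mult, Cmod_R, Cmod_pow, (Rabs_pos_eq (INR n)) by apply pos_INR.
    eapply Rle_trans; [|apply (Hdom n (INR n / r))].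
    - destruct n as [|n]; [simpl; lra|].
      replace (Cmod (b (S n)) * r ^ S n * (INR (S n) / r))
        with (Cmod (b (S n)) * (INR (S n) * r ^ n)) by (simpl pow; field; lra).
      apply Rmult_le_compat_l; [apply Cmod_ge_0|].
      apply Rmult_le_compat_l; [apply pos_INR|].
      apply pow_incr. split; [apply Cmod_ge_0|simpl; lra].
    - apply Rdiv_le_0_compat; [apply pos_INR|lra].
    - pose proof (pos_INR n). pose proof (HN n). unfold Rdiv.
      rewrite Rmult_comm. apply Rmult_le_compat; lra. }
  assert (Ed : cps (dcoef b) z = CSeries (fun n => b n * (INR n * z ^ pred n))%C).
  { unfold cps, CSeries, dcoef. f_equal.
    - rewrite (Series_incr_1_aux (fun n => Re (b n * (INR n * z ^ pred n))%C)).
      + apply Series_ext. intros n. f_equal. simpl pred. ring.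
      + simpl. ring.
    - rewrite (Series_incr_1_aux (fun n => Im (b n * (INR n * z ^ pred n))%C)).
      + apply Series_ext. intros n. f_equal. simpl pred. ring.
      + simpl. ring. }
  apply cderiv_bound. intros eps He.
  set (L := 2 * Series M).
  assert (HL : 0 <= L).
  { eapply Rle_trans; [apply Cmod_ge_0|].
    apply (CSeries_bound (fun n => b n * z ^ n)%C M); [|exact HM].
    intros n. apply Dpow. lra. }
  exists (Rmin (r - Cmod z) (eps / (L + 1))). split.
  { apply Rmin_glb_lt; [lra|]. apply Rdiv_lt_0_compat; lra. }
  intros h Hh.
  assert (H1 : Cmod h < r - Cmod z) by (eapply Rlt_le_trans; [exact Hh|apply Rmin_l]).
  assert (H2 : Cmod h < eps / (L + 1)) by (eapply Rlt_le_trans; [exact Hh|apply Rmin_r]).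
  pose proof (Cmod_ge_0 h) as Hh0.
  assert (Hzh : Cmod (z + h)%C <= r) by (pose proof (Cmod_triangle z h); lra).
  rewrite Ed. unfold cps.
  rewrite (CSeries_linear_remainder _ _ _ M) by
    (try exact HM; intros n; first [apply Dder | apply Dpow; lra]).
  eapply Rle_trans.
  { apply (CSeries_bound _ (fun n => Cmod h * Cmod h * M n)).
    - intros n.
      replace (b n * (z + h) ^ n - b n * z ^ n
               - h * (b n * (INR n * z ^ pred n)))%C
        with (b n * ((z + h) ^ n - z ^ n - h * (INR n * z ^ pred n)))%C by ring.
      rewrite Cmod_mult.
      eapply Rle_trans.
      { apply Rmult_le_compat_l; [apply Cmod_ge_0|].
        apply (pow_remainder z h r n); lra. }
      replace (Cmod (b n) * (Cmod h * Cmod h * (INR n * INR n * r ^ n / (r * r))))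
        with (Cmod h * Cmod h * (Cmod (b n) * r ^ n * (INR n * INR n / (r * r))))
        by (field; lra).
      apply Rmult_le_compat_l; [nra|].
      pose proof (pos_INR n).
      apply Hdom.
      + apply Rdiv_le_0_compat; nra.
      + unfold Rdiv. rewrite Rmult_comm. apply Rmult_le_compat; nra.
    - exact (ex_series_scal_l (Cmod h * Cmod h) M HM). }
  rewrite Series_scal_l.
  replace (2 * (Cmod h * Cmod h * Series M)) with (Cmod h * (Cmod h * L)) by (unfold L; ring).
  rewrite (Rmult_comm eps). apply Rmult_le_compat_l; [exact Hh0|].
  apply (Rmult_lt_compat_r (L + 1)) in H2; [|lra].
  replace (eps / (L + 1) * (L + 1)) with eps in H2 by (field; lra). nra.
Qed.

Lemma Cdiff_cps n : forall b B, radius_ge b B -> Cdiff n B (cps b).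
Proof.
  induction n as [|n IH]; intros b B H; [exact I|].
  exists (cps (dcoef b)). split.
  - intros z Hz. now apply cderiv_cps with B.
  - apply IH. now apply radius_ge_dcoef.
Qed.

Fixpoint csum (a : nat -> C) (n : nat) : C :=
  match n with O => RtoC 0 | S n => (csum a n + a n)%C end.

(** Recognizes a Neumann series, known through the error of its partial sums, as
    a power series in its parameter. *)
Lemma CSeries_eq (a : nat -> C) (l : C) (M x : R) :
  0 <= x < 1 -> (forall n, Cmod (l - csum a n)%C <= M * x ^ n) -> CSeries a = l.
Proof.
  intros Hx H.
  assert (G : forall (p : C -> R), (forall z w, p (z + w)%C = p z + p w) ->
    (forall z, Rabs (p z) <= Cmod z) -> Series (fun n => p (a n)) = p l).
  { intros p Hp Hb.
    assert (Hopp : forall z w, p (z - w)%C = p z - p w).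
    { intros z w. pose proof (Hp (z - w)%C w) as E.
      replace (z - w + w)%C with z in E by ring. lra. }
    apply is_series_unique.
    assert (Hsum : forall n, sum_n (fun k => p (a k)) n = p (csum a (S n))).
    { induction n as [|n IH].
      - rewrite sum_O. simpl. f_equal. ring.
      - rewrite sum_Sn, IH. change (csum a (S (S n))) with (csum a (S n) + a (S n))%C.
        now rewrite Hp. }
    change (is_lim_seq (sum_n (fun k => p (a k))) (p l)).
    apply (is_lim_seq_ext (fun n => p (csum a (S n)))); [intros; now rewrite Hsum|].
    assert (Z : is_lim_seq (fun n => M * x ^ S n) 0).
    { replace (Finite 0) with (Rbar_mult M 0) by (simpl; f_equal; ring).
      apply is_lim_seq_scal_l.
      apply (is_lim_seq_incr_1 (fun n => x ^ n)).
      apply is_lim_seq_geom. rewrite Rabs_pos_eq; lra. }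
    apply (is_lim_seq_le_le (fun n => p l - M * x ^ S n) _ (fun n => p l + M * x ^ S n)).
    - intros n. pose proof (Hb (l - csum a (S n))%C) as B. rewrite Hopp in B.
      pose proof (H (S n)) as B2. apply Rabs_le_between in B. lra.
    - replace (Finite (p l)) with (Finite (p l - 0)) by (f_equal; ring).
      apply is_lim_seq_minus'; [apply is_lim_seq_const|exact Z].
    - replace (Finite (p l)) with (Finite (p l + 0)) by (f_equal; ring).
      apply is_lim_seq_plus'; [apply is_lim_seq_const|exact Z]. }
  unfold CSeries. rewrite (G Re), (G Im).
  - now destruct l.
  - reflexivity.
  - apply Im_le_Cmod.
  - reflexivity.
  - apply re_le_Cmod.
Qed.

(** * Volterra integral equations *)

(** Componentwise, so that real calculus applies directly. *)
Definition rderiv (f : R -> C) (t : R) (l : C) : Prop :=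
  is_derive (fun s => Re (f s)) t (Re l) /\ is_derive (fun s => Im (f s)) t (Im l).

Definition rcont (f : R -> C) : Prop :=
  forall t, continuous (fun s => Re (f s)) t /\ continuous (fun s => Im (f s)) t.

Lemma rderiv_eq f t l l' : rderiv f t l -> l = l' -> rderiv f t l'.
Proof. now intros H <-. Qed.

Lemma rderiv_ext f g t l : (forall s, f s = g s) -> rderiv f t l -> rderiv g t l.
Proof.
  intros E [H1 H2].
  split; (eapply is_derive_ext; [|eassumption]); intros s; cbv beta; now rewrite E.
Qed.

Lemma rderiv_const a t : rderiv (fun _ => a) t 0.
Proof. split; apply (is_derive_const (V := R_NormedModule)). Qed.

Lemma rderiv_plus f g t lf lg :
  rderiv f t lf -> rderiv g t lg -> rderiv (fun s => f s + g s)%C t (lf + lg)%C.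
Proof.
  intros [F1 F2] [G1 G2].
  split; apply (is_derive_plus (V := R_NormedModule)); assumption.
Qed.

Lemma rderiv_mult f g t lf lg :
  rderiv f t lf -> rderiv g t lg ->
  rderiv (fun s => f s * g s)%C t (lf * g t + f t * lg)%C.
Proof.
  intros [F1 F2] [G1 G2].
  assert (M : forall (p q : R -> R) (dp dq : R), is_derive p t dp -> is_derive q t dq ->
            is_derive (fun s => p s * q s) t (dp * q t + p t * dq)).
  { intros p q dp dq Hp Hq.
    exact (is_derive_mult p q t dp dq Hp Hq Rmult_comm). }
  split.
  - eapply is_derive_ext with (f := fun s => Re (f s) * Re (g s) - Im (f s) * Im (g s)).
    { intros s. destruct (f s), (g s). reflexivity. }
    replace (Re (lf * g t + f t * lg)%C)
      with (Rminus (Re lf * Re (g t) + Re (f t) * Re lg)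
                   (Im lf * Im (g t) + Im (f t) * Im lg))
      by (destruct lf, lg, (f t), (g t); simpl; ring).
    apply (is_derive_minus (V := R_NormedModule)); apply M; assumption.
  - eapply is_derive_ext with (f := fun s => Re (f s) * Im (g s) + Im (f s) * Re (g s)).
    { intros s. destruct (f s), (g s). reflexivity. }
    replace (Im (lf * g t + f t * lg)%C)
      with (Rplus (Re lf * Im (g t) + Re (f t) * Im lg)
                   (Im lf * Re (g t) + Im (f t) * Re lg))
      by (destruct lf, lg, (f t), (g t); simpl; ring).
    apply (is_derive_plus (V := R_NormedModule)); apply M; assumption.
Qed.

Lemma rderiv_rcont f f' : (forall t, rderiv f t (f' t)) -> rcont f.
Proof.
  intros H t. destruct (H t) as [H1 H2].
  split; apply (ex_derive_continuous (V := R_NormedModule)); eexists; eassumption.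
Qed.

Lemma rcont_const a : rcont (fun _ => a).
Proof. intros t. split; apply continuous_const. Qed.

Lemma rcont_plus f g : rcont f -> rcont g -> rcont (fun s => f s + g s)%C.
Proof.
  intros F G t. destruct (F t), (G t).
  split; apply (continuous_plus (V := R_NormedModule)); assumption.
Qed.

Lemma rcont_mult f g : rcont f -> rcont g -> rcont (fun s => f s * g s)%C.
Proof.
  intros F G t. destruct (F t) as [F1 F2], (G t) as [G1 G2]. split.
  - apply (continuous_minus (V := R_NormedModule) (fun s => Re (f s) * Re (g s))
             (fun s => Im (f s) * Im (g s)));
      apply (continuous_mult (K := R_AbsRing)); assumption.
  - apply (continuous_plus (V := R_NormedModule) (fun s => Re (f s) * Im (g s))
             (fun s => Im (f s) * Re (g s)));
      apply (continuous_mult (K := R_AbsRing)); assumption.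
Qed.

Definition CInt (f : R -> C) (z : R) : C :=
  (RInt (fun y => Re (f y)) 0 z, RInt (fun y => Im (f y)) 0 z).

Lemma rcont_ex_RInt f a b : rcont f ->
  ex_RInt (fun y => Re (f y)) a b /\ ex_RInt (fun y => Im (f y)) a b.
Proof.
  intros H. split; apply (ex_RInt_continuous (V := R_CompleteNormedModule));
    intros z _; apply H.
Qed.

Lemma CInt_ext f g z : (forall y, f y = g y) -> CInt f z = CInt g z.
Proof.
  intros H. unfold CInt. f_equal; apply RInt_ext; intros y _; now rewrite H.
Qed.

Lemma CInt_linear f g (a : C) z : rcont f -> rcont g ->
  CInt (fun y => f y + a * g y)%C z = (CInt f z + a * CInt g z)%C.
Proof.
  intros F G.
  destruct (rcont_ex_RInt f 0 z F) as [f1 f2], (rcont_ex_RInt g 0 z G) as [g1 g2].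
  destruct a as (p, q).
  assert (L : forall (u v w : R -> R) (p q : R), ex_RInt u 0 z -> ex_RInt v 0 z ->
    ex_RInt w 0 z -> RInt (fun y => u y + (p * v y + q * w y)) 0 z =
    RInt u 0 z + (p * RInt v 0 z + q * RInt w 0 z)).
  { intros u v w c d Hu Hv Hw.
    assert (V : ex_RInt (fun y => c * v y) 0 z) by exact (ex_RInt_scal v 0 z c Hv).
    assert (W : ex_RInt (fun y => d * w y) 0 z) by exact (ex_RInt_scal w 0 z d Hw).
    assert (VW : ex_RInt (fun y => c * v y + d * w y) 0 z) by exact (ex_RInt_plus _ _ 0 z V W).
    assert (EV : RInt (fun y => c * v y) 0 z = c * RInt v 0 z)
      by exact (RInt_scal v 0 z c Hv).
    assert (EW : RInt (fun y => d * w y) 0 z = d * RInt w 0 z)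
      by exact (RInt_scal w 0 z d Hw).
    transitivity (RInt u 0 z + RInt (fun y => c * v y + d * w y) 0 z).
    { exact (RInt_plus u (fun y => c * v y + d * w y) 0 z Hu VW). }
    f_equal. rewrite <- EV, <- EW.
    exact (RInt_plus (fun y => c * v y) (fun y => d * w y) 0 z V W). }
  apply injective_projections.
  - change (RInt (fun y => Re (f y + (p, q) * g y)%C) 0 z =
      RInt (fun y => Re (f y)) 0 z +
      (p * RInt (fun y => Re (g y)) 0 z - q * RInt (fun y => Im (g y)) 0 z)).
    transitivity (RInt (fun y => Re (f y) + (p * Re (g y) + - q * Im (g y))) 0 z).
    + apply RInt_ext. intros y _. destruct (f y), (g y). simpl. ring.
    + eapply eq_trans; [exact (L _ _ _ _ _ f1 g1 g2)|].
      match goal with |- ?l = ?r => change (@eq R l r) end. ring.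
  - change (RInt (fun y => Im (f y + (p, q) * g y)%C) 0 z =
      RInt (fun y => Im (f y)) 0 z +
      (p * RInt (fun y => Im (g y)) 0 z + q * RInt (fun y => Re (g y)) 0 z)).
    transitivity (RInt (fun y => Im (f y) + (p * Im (g y) + q * Re (g y))) 0 z).
    + apply RInt_ext. intros y _. destruct (f y), (g y). simpl. ring.
    + eapply eq_trans; [exact (L _ _ _ _ _ f2 g2 g1)|].
      match goal with |- ?l = ?r => change (@eq R l r) end. ring.
Qed.

Lemma CInt_real w z : CInt (fun y => RtoC (w y)) z = RtoC (RInt w 0 z).
Proof.
  unfold CInt, RtoC. simpl. f_equal. rewrite RInt_const.
  change ((z - 0) * 0 = 0 :> R). ring.
Qed.

Lemma CInt_scal f (a : C) z : rcont f ->
  CInt (fun y => a * f y)%C z = (a * CInt f z)%C.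
Proof.
  intros F.
  rewrite (CInt_ext _ (fun y => RtoC 0 + a * f y)%C) by (intros; ring).
  rewrite (CInt_linear (fun _ => RtoC 0) f a z (rcont_const 0) F), CInt_real.
  replace (RInt (fun _ => 0) 0 z) with 0; [ring|].
  rewrite RInt_const. symmetry. apply Rmult_0_r.
Qed.

Lemma CInt_bound f z M : rcont f -> 0 <= z ->
  (forall y, 0 <= y <= z -> Cmod (f y) <= M) -> Cmod (CInt f z) <= 2 * z * M.
Proof.
  intros F Hz H.
  destruct (rcont_ex_RInt f 0 z F) as [f1 f2].
  eapply Rle_trans; [apply Cmod_le_Re_Im|].
  replace (2 * z * M) with ((z - 0) * M + (z - 0) * M) by ring.
  apply Rplus_le_compat; apply abs_RInt_le_const; auto; intros t Ht;
    (eapply Rle_trans; [|apply (H t Ht)]); [apply re_le_Cmod|apply Im_le_Cmod].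
Qed.

Lemma CInt_FTC f f' z : (forall t, rderiv f t (f' t)) -> rcont f' ->
  CInt f' z = (f z - f 0)%C.
Proof.
  intros H Hc. apply injective_projections.
  - apply (is_RInt_unique (V := R_CompleteNormedModule)).
    apply (is_RInt_derive (V := R_CompleteNormedModule) (fun s => Re (f s)) (fun s => Re (f' s))).
    + intros x _. apply H.
    + intros x _. apply Hc.
  - apply (is_RInt_unique (V := R_CompleteNormedModule)).
    apply (is_RInt_derive (V := R_CompleteNormedModule) (fun s => Im (f s)) (fun s => Im (f' s))).
    + intros x _. apply H.
    + intros x _. apply Hc.
Qed.

Lemma CInt_rcont f : rcont f -> rcont (CInt f).
Proof.
  intros F z. split.
  - apply (ex_derive_continuous (V := R_NormedModule)). exists (Re (f z)).
    apply (is_derive_RInt (V := R_NormedModule) (fun y => Re (f y)) _ 0).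
    + apply filter_forall. intros x.
      apply (RInt_correct (V := R_CompleteNormedModule)). exact (proj1 (rcont_ex_RInt f 0 x F)).
    + apply F.
  - apply (ex_derive_continuous (V := R_NormedModule)). exists (Im (f z)).
    apply (is_derive_RInt (V := R_NormedModule) (fun y => Im (f y)) _ 0).
    + apply filter_forall. intros x.
      apply (RInt_correct (V := R_CompleteNormedModule)). exact (proj2 (rcont_ex_RInt f 0 x F)).
    + apply F.
Qed.

Lemma rcont_bounded f T : rcont f -> 0 <= T ->
  exists M, 0 <= M /\ forall z, 0 <= z <= T -> Cmod (f z) <= M.
Proof.
  intros F HT.
  destruct (continuity_ab_maj (fun s => Rabs (Re (f s)) + Rabs (Im (f s))) 0 T HT)
    as (x & Hx & _).
  { intros c _. apply continuity_pt_filterlim.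
    apply (continuous_plus (V := R_NormedModule) (fun s => Rabs (Re (f s)))
             (fun s => Rabs (Im (f s))));
      (apply continuous_comp; [apply F|apply continuous_Rabs]). }
  eexists. split.
  2:{ intros z Hz. eapply Rle_trans; [apply Cmod_le_Re_Im|]. exact (Hx z Hz). }
  cbv beta. pose proof (Rabs_pos (Re (f x))). pose proof (Rabs_pos (Im (f x))). lra.
Qed.

(** When y1, y2 solve y'' = Q y with Wronskian 1, this is the solution of
    u'' = Q u + phi with vanishing data at 0, by variation of constants. *)
Definition volterra (y1 y2 phi : R -> C) (z : R) : C :=
  (y2 z * CInt (fun y => y1 y * phi y) z - y1 z * CInt (fun y => y2 y * phi y) z)%C.

Fixpoint iterate (y1 y2 phi : R -> C) (n : nat) : R -> C :=
  match n with
  | O => phi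
  | S n => volterra y1 y2 (iterate y1 y2 phi n)
  end.

Lemma volterra_rcont y1 y2 phi :
  rcont y1 -> rcont y2 -> rcont phi -> rcont (volterra y1 y2 phi).
Proof.
  intros H1 H2 H. unfold volterra.
  assert (E : forall g, rcont (fun z => (g z + RtoC (-1) * (y1 z * CInt (fun y => y2 y * phi y) z))%C)
     -> rcont (fun z => (g z - y1 z * CInt (fun y => y2 y * phi y) z)%C)).
  { intros g Hg t. destruct (Hg t) as [G1 G2]. split.
    - eapply continuous_ext; [|exact G1]. intros s. cbv beta. f_equal. ring.
    - eapply continuous_ext; [|exact G2]. intros s. cbv beta. f_equal. ring. }
  assert (I1 : rcont (CInt (fun y => y1 y * phi y)%C)) by (apply CInt_rcont; now apply rcont_mult).
  assert (I2 : rcont (CInt (fun y => y2 y * phi y)%C)) by (apply CInt_rcont; now apply rcont_mult).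
  apply (E (fun z => y2 z * CInt (fun y => y1 y * phi y) z)%C).
  apply rcont_plus; [now apply rcont_mult|].
  apply rcont_mult; [apply rcont_const|now apply rcont_mult].
Qed.

Lemma iterate_rcont y1 y2 phi n :
  rcont y1 -> rcont y2 -> rcont phi -> rcont (iterate y1 y2 phi n).
Proof.
  intros H1 H2 H. induction n as [|n IH]; [exact H|]. now apply volterra_rcont.
Qed.

Lemma volterra_linear y1 y2 f g a z :
  rcont y1 -> rcont y2 -> rcont f -> rcont g ->
  volterra y1 y2 (fun y => f y + a * g y)%C z
  = (volterra y1 y2 f z + a * volterra y1 y2 g z)%C.
Proof.
  intros H1 H2 F G. unfold volterra.
  rewrite (CInt_ext (fun y => y1 y * (f y + a * g y))%C
             (fun y => y1 y * f y + a * (y1 y * g y))%C) by (intros; ring).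
  rewrite (CInt_ext (fun y => y2 y * (f y + a * g y))%C
             (fun y => y2 y * f y + a * (y2 y * g y))%C) by (intros; ring).
  rewrite !CInt_linear by (now apply rcont_mult). ring.
Qed.

Section Neumann.

Variables (y1 y2 : R -> C) (T Y : R).
Hypothesis (c1 : rcont y1) (c2 : rcont y2) (HT : 0 <= T) (HY : 0 <= Y).
Hypothesis b1 : forall z, 0 <= z <= T -> Cmod (y1 z) <= Y.
Hypothesis b2 : forall z, 0 <= z <= T -> Cmod (y2 z) <= Y.

Lemma CInt_weighted_bound w f M z : rcont w -> rcont f -> 0 <= z <= T ->
  (forall y, 0 <= y <= T -> Cmod (w y) <= Y) ->
  (forall y, 0 <= y <= T -> Cmod (f y) <= M) ->
  Cmod (CInt (fun y => w y * f y)%C z) <= 2 * T * (Y * M).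
Proof.
  intros W F Hz BW BF.
  assert (0 <= M) by (eapply Rle_trans; [apply Cmod_ge_0|apply (BF z Hz)]).
  eapply Rle_trans.
  - apply (CInt_bound _ z (Y * M)); [now apply rcont_mult|lra|].
    intros y Hy. rewrite Cmod_mult.
    apply Rmult_le_compat; try apply Cmod_ge_0; [apply BW|apply BF]; lra.
  - apply Rmult_le_compat_r; [now apply Rmult_le_pos|lra].
Qed.

(** On [0, T] the operator has norm at most 4 T Y^2; the factor 2 in the bound
    of each integral comes from estimating real and imaginary parts apart. *)
Lemma volterra_bound f M z : rcont f -> 0 <= z <= T ->
  (forall y, 0 <= y <= T -> Cmod (f y) <= M) ->
  Cmod (volterra y1 y2 f z) <= 4 * T * (Y * Y) * M.
Proof.
  intros F Hz BF. unfold volterra, Cminus.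
  eapply Rle_trans; [apply Cmod_triangle|]. rewrite Cmod_opp, !Cmod_mult.
  replace (4 * T * (Y * Y) * M) with (Y * (2 * T * (Y * M)) + Y * (2 * T * (Y * M))) by ring.
  apply Rplus_le_compat; apply Rmult_le_compat; try apply Cmod_ge_0; auto;
    apply CInt_weighted_bound; auto.
Qed.

Let B := 4 * T * (Y * Y).

Lemma iterate_bound phi M n : rcont phi ->
  (forall y, 0 <= y <= T -> Cmod (phi y) <= M) ->
  forall z, 0 <= z <= T -> Cmod (iterate y1 y2 phi n z) <= M * B ^ n.
Proof.
  intros F BF. induction n as [|n IH]; intros z Hz; simpl.
  - rewrite Rmult_1_r. auto.
  - replace (M * (B * B ^ n)) with (4 * T * (Y * Y) * (M * B ^ n)) by (unfold B; ring).
    apply volterra_bound; auto. now apply iterate_rcont.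
Qed.

Variables (u u0 : R -> C) (nu : C) (U : R).
Hypothesis (cu : rcont u) (cu0 : rcont u0).
Hypothesis bu : forall z, 0 <= z <= T -> Cmod (u z) <= U.
Hypothesis eu : forall z, u z = (u0 z + nu * volterra y1 y2 u z)%C.

(** What is left of u after n terms of its Neumann series. *)
Fixpoint neumann_error (n : nat) : R -> C :=
  match n with
  | O => u
  | S n => fun z => (neumann_error n z + (- nu ^ n) * iterate y1 y2 u0 n z)%C
  end.

Lemma neumann_error_rcont n : rcont (neumann_error n).
Proof.
  induction n as [|n IH]; simpl; [exact cu|].
  apply rcont_plus; [exact IH|].
  apply rcont_mult; [apply rcont_const|now apply iterate_rcont].
Qed.

(** Applying nu times the operator to the n-th error shifts every term of the
    partial sum by one, and u0 is restored by the integral equation. *)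
Lemma neumann_error_succ n z :
  neumann_error (S n) z = (nu * volterra y1 y2 (neumann_error n) z)%C.
Proof.
  revert z. induction n as [|n IH]; intros z.
  - simpl. rewrite (eu z) at 1. ring.
  - change (neumann_error (S (S n)) z)
      with (neumann_error (S n) z + (- nu ^ S n) * volterra y1 y2 (iterate y1 y2 u0 n) z)%C.
    rewrite IH. simpl neumann_error.
    rewrite volterra_linear by (auto using neumann_error_rcont, iterate_rcont).
    rewrite Cpow_S. ring.
Qed.

Lemma neumann_error_bound n z : 0 <= z <= T ->
  Cmod (neumann_error n z) <= U * (B * Cmod nu) ^ n.
Proof.
  revert z. induction n as [|n IH]; intros z Hz.
  - simpl. rewrite Rmult_1_r. auto.
  - rewrite neumann_error_succ, Cmod_mult.
    replace (U * (B * Cmod nu) ^ S n)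
      with (Cmod nu * (4 * T * (Y * Y) * (U * (B * Cmod nu) ^ n)))
      by (unfold B; simpl; ring).
    apply Rmult_le_compat_l; [apply Cmod_ge_0|].
    apply volterra_bound; auto using neumann_error_rcont.
Qed.

Lemma neumann_series w n : rcont w -> (forall z, 0 <= z <= T -> Cmod (w z) <= Y) ->
  Cmod (CInt (fun y => w y * u y) T
        - csum (fun k => CInt (fun y => w y * iterate y1 y2 u0 k y) T * nu ^ k) n)%C
  <= 2 * T * Y * U * (B * Cmod nu) ^ n.
Proof.
  intros W BW.
  assert (E : forall m, CInt (fun y => w y * neumann_error m y)%C T =
    (CInt (fun y => w y * u y) T
        - csum (fun k => CInt (fun y => w y * iterate y1 y2 u0 k y) T * nu ^ k) m)%C).
  { induction m as [|m IH]; [simpl; ring|].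
    simpl csum. simpl neumann_error.
    rewrite (CInt_ext _ (fun y => w y * neumann_error m y +
      (- nu ^ m) * (w y * iterate y1 y2 u0 m y))%C) by (intros; ring).
    rewrite CInt_linear, IH; [ring| |]; apply rcont_mult;
      auto using neumann_error_rcont, iterate_rcont. }
  rewrite <- E.
  replace (2 * T * Y * U * (B * Cmod nu) ^ n)
    with (2 * T * (Y * (U * (B * Cmod nu) ^ n))) by ring.
  apply CInt_weighted_bound; auto using neumann_error_rcont; [lra|].
  intros; now apply neumann_error_bound.
Qed.

End Neumann.

(** * Hill's equation *)

(** The equation u'' = (Q + nu) u as a first-order system with v = u'. *)
Definition hill_solution (Q : R -> R) (nu : C) (u v : R -> C) : Prop :=
  forall t, rderiv u t (v t) /\ rderiv v t ((RtoC (Q t) + nu) * u t)%C.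

Lemma hill_solution_rcont Q nu u v : hill_solution Q nu u v -> rcont u /\ rcont v.
Proof.
  intros H. split.
  - apply (rderiv_rcont u v). intros t. apply H.
  - apply (rderiv_rcont v (fun t => (RtoC (Q t) + nu) * u t)%C). intros t. apply H.
Qed.

Lemma wronskian_derivative Q nu mu y p u v t :
  hill_solution Q mu y p -> hill_solution Q nu u v ->
  rderiv (fun s => y s * v s + RtoC (-1) * (p s * u s))%C t ((nu - mu) * (y t * u t))%C.
Proof.
  intros Hy Hu. destruct (Hy t) as [Y1 Y2], (Hu t) as [U1 U2].
  eapply rderiv_eq.
  - apply (rderiv_plus (fun s => y s * v s)%C).
    + apply (rderiv_mult y v); eassumption.
    + apply (rderiv_mult (fun _ => RtoC (-1)) (fun s => p s * u s)%C).
      * apply rderiv_const.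
      * apply (rderiv_mult p u); eassumption.
  - cbv beta. ring.
Qed.

(** The modified Wronskian y v - p u has derivative (nu - mu) y u.  For mu = nu it
    is constant; for mu = 0 the identity is variation of constants. *)
Lemma lagrange_identity Q nu mu y p u v z :
  hill_solution Q mu y p -> hill_solution Q nu u v ->
  (y z * v z - p z * u z)%C =
  (y 0 * v 0 - p 0 * u 0 + (nu - mu) * CInt (fun s => y s * u s) z)%C.
Proof.
  intros Hy Hu.
  destruct (hill_solution_rcont _ _ _ _ Hy) as [cy _].
  destruct (hill_solution_rcont _ _ _ _ Hu) as [cu _].
  assert (cyu : rcont (fun s => y s * u s)%C) by now apply rcont_mult.
  pose proof (CInt_FTC _ (fun t => (nu - mu) * (y t * u t))%C z
    (fun t => wronskian_derivative Q nu mu y p u v t Hy Hu)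
    (rcont_mult _ _ (rcont_const (nu - mu)%C) cyu)) as E. cbv beta in E.
  rewrite CInt_scal in E by exact cyu.
  transitivity ((y z * v z + RtoC (-1) * (p z * u z))
                - (y 0 * v 0 + RtoC (-1) * (p 0 * u 0))
                + (y 0 * v 0 - p 0 * u 0))%C; [ring|].
  rewrite <- E. ring.
Qed.

(** Variation of constants expresses u1, u2 as solutions of Volterra equations
    driven by y1, y2.  At T, where y1 = 1, p1 = 0 and p2 = 1, it yields
    u1 + v2 = 2 + nu (y2(T) int y1 u1 - int y2 u1 + int y1 u2).  Inserting the
    Neumann series of u1 and u2 gives the power series of the bracket; in its
    constant term the last two integrals cancel. *)
Lemma hill_discriminant (Q : R -> R) (y1 p1 y2 p2 : R -> C) (T : R) :
  0 < T ->
  hill_solution Q 0 y1 p1 -> hill_solution Q 0 y2 p2 ->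
  y1 0 = 1 -> p1 0 = 0 -> y2 0 = 0 -> p2 0 = 1 -> y1 T = 1 -> p1 T = 0 ->
  exists b B, 0 < B /\ radius_ge b B /\
    b O = (y2 T * CInt (fun s => y1 s * y1 s) T)%C /\
    forall nu u1 v1 u2 v2, Cmod nu < B ->
      hill_solution Q nu u1 v1 -> hill_solution Q nu u2 v2 ->
      u1 0 = 1 -> v1 0 = 0 -> u2 0 = 0 -> v2 0 = 1 ->
      (u1 T + v2 T)%C = (2 + nu * cps b nu)%C /\
      (u1 T * v2 T - u2 T * v1 T)%C = 1.
Proof.
  intros HT S1 S2 i1 i2 i3 i4 m1 m2.
  destruct (hill_solution_rcont _ _ _ _ S1) as [c1 _].
  destruct (hill_solution_rcont _ _ _ _ S2) as [c2 _].
  assert (W : forall z, (y1 z * p2 z - y2 z * p1 z)%C = 1).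
  { intros z. pose proof (lagrange_identity Q 0 0 y1 p1 y2 p2 z S1 S2) as E.
    rewrite i1, i2, i3, i4 in E.
    transitivity (y1 z * p2 z - p1 z * y2 z)%C; [ring|]. rewrite E. ring. }
  assert (m3 : p2 T = 1).
  { specialize (W T). rewrite m1, m2 in W. rewrite <- W. ring. }
  destruct (rcont_bounded y1 T c1) as (Y1 & HY1 & B1); [lra|].
  destruct (rcont_bounded y2 T c2) as (Y2 & HY2 & B2); [lra|].
  set (Y := 1 + Y1 + Y2).
  assert (HY : 0 <= Y) by (unfold Y; lra).
  assert (BY1 : forall z, 0 <= z <= T -> Cmod (y1 z) <= Y)
    by (intros z Hz; specialize (B1 z Hz); unfold Y; lra).
  assert (BY2 : forall z, 0 <= z <= T -> Cmod (y2 z) <= Y)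
    by (intros z Hz; specialize (B2 z Hz); unfold Y; lra).
  set (rate := 4 * T * (Y * Y)).
  assert (Hrate : 0 < rate).
  { unfold rate. repeat apply Rmult_lt_0_compat; unfold Y; lra. }
  set (m := y2 T).
  set (L := fun (w u0 : R -> C) (n : nat) =>
    CInt (fun y => w y * iterate y1 y2 u0 n y)%C T).
  set (b := fun n : nat => (m * L y1 y1 n - L y2 y1 n + L y1 y2 n)%C).
  exists b, (/ rate). split; [now apply Rinv_0_lt_compat|].
  assert (HL : forall w u0 n, rcont w -> (forall z, 0 <= z <= T -> Cmod (w z) <= Y) ->
    rcont u0 -> (forall z, 0 <= z <= T -> Cmod (u0 z) <= Y) ->
    Cmod (L w u0 n) <= 2 * T * (Y * Y) * rate ^ n).
  { intros w u0 n cw bw c0 b0. unfold L.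
    replace (2 * T * (Y * Y) * rate ^ n) with (2 * T * (Y * (Y * rate ^ n))) by ring.
    apply (CInt_weighted_bound T Y); auto; [now apply iterate_rcont|lra|].
    intros z Hz. now apply iterate_bound. }
  repeat split.
  - intros r Hr. set (K := 2 * T * (Y * Y)).
    exists ((Cmod m + 2) * K). intros n.
    assert (Hb : Cmod (b n) <= (Cmod m + 2) * K * rate ^ n).
    { unfold b, Cminus.
      eapply Rle_trans; [apply Cmod_triangle|].
      eapply Rle_trans; [apply Rplus_le_compat_r, Cmod_triangle|].
      rewrite Cmod_opp, Cmod_mult.
      assert (X1 : Cmod m * Cmod (L y1 y1 n) <= Cmod m * (K * rate ^ n))
        by (apply Rmult_le_compat_l; [apply Cmod_ge_0|now apply HL]).
      pose proof (HL y2 y1 n c2 BY2 c1 BY1) as X2.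
      pose proof (HL y1 y2 n c1 BY1 c2 BY2) as X3.
      fold K in X2, X3. lra. }
    assert (Hrr : 0 <= rate * r <= 1).
    { split; [apply Rmult_le_pos; lra|].
      rewrite <- (Rinv_r rate) by lra. apply Rmult_le_compat_l; lra. }
    assert (HK : 0 <= (Cmod m + 2) * K).
    { apply Rmult_le_pos; [pose proof (Cmod_ge_0 m); lra|].
      unfold K. repeat apply Rmult_le_pos; lra. }
    apply Rle_trans with ((Cmod m + 2) * K * rate ^ n * r ^ n).
    { apply Rmult_le_compat_r; [apply pow_le; lra|exact Hb]. }
    rewrite Rmult_assoc, <- Rpow_mult_distr.
    rewrite <- (Rmult_1_r ((Cmod m + 2) * K)) at 2.
    apply Rmult_le_compat_l; [exact HK|].
    rewrite <- (pow1 n). now apply pow_incr.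
  - unfold b, L. simpl iterate.
    rewrite (CInt_ext (fun y => y2 y * y1 y)%C (fun y => y1 y * y2 y)%C) by (intros; ring).
    fold m. ring.
  - rename H into Hnu, H0 into U1, H1 into U2, H2 into j1, H3 into j2, H4 into j3, H5 into j4.
    destruct (hill_solution_rcont _ _ _ _ U1) as [cu1 _].
    destruct (hill_solution_rcont _ _ _ _ U2) as [cu2 _].
    assert (V : forall u v, hill_solution Q nu u v ->
      (forall z, u z = u 0 * y1 z + v 0 * y2 z + nu * volterra y1 y2 u z)%C /\
      (v T = v 0 + nu * CInt (fun s => y1 s * u s) T)%C).
    { intros u v Hu.
      assert (P : forall z, (y1 z * v z - p1 z * u z = v 0 + nu * CInt (fun s => y1 s * u s) z)%C).
      { intros z. rewrite (lagrange_identity Q nu 0 y1 p1 u v z S1 Hu), i1, i2. ring. }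
      assert (R : forall z, (y2 z * v z - p2 z * u z = - u 0 + nu * CInt (fun s => y2 s * u s) z)%C).
      { intros z. rewrite (lagrange_identity Q nu 0 y2 p2 u v z S2 Hu), i3, i4. ring. }
      split.
      - intros z. unfold volterra.
        transitivity (u z * (y1 z * p2 z - y2 z * p1 z))%C; [rewrite W; ring|].
        transitivity (y2 z * (y1 z * v z - p1 z * u z)
                      - y1 z * (y2 z * v z - p2 z * u z))%C; [ring|].
        rewrite P, R. ring.
      - rewrite <- P, m1, m2. ring. }
    destruct (V u1 v1 U1) as [E1 _]. destruct (V u2 v2 U2) as [E2 E2'].
    rewrite j1, j2 in E1. rewrite j3, j4 in E2. rewrite j4 in E2'.
    destruct (rcont_bounded u1 T cu1) as (M1 & HM1 & BU1); [lra|].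
    destruct (rcont_bounded u2 T cu2) as (M2 & HM2 & BU2); [lra|].
    assert (E1' : forall z, u1 z = (y1 z + nu * volterra y1 y2 u1 z)%C)
      by (intros z; rewrite (E1 z) at 1; ring).
    assert (E2'' : forall z, u2 z = (y2 z + nu * volterra y1 y2 u2 z)%C)
      by (intros z; rewrite (E2 z) at 1; ring).
    assert (N1 := fun w n => neumann_series y1 y2 T Y c1 c2 (Rlt_le _ _ HT) HY BY1 BY2
      u1 y1 nu M1 cu1 c1 BU1 E1' w n).
    assert (N2 := fun w n => neumann_series y1 y2 T Y c1 c2 (Rlt_le _ _ HT) HY BY1 BY2
      u2 y2 nu M2 cu2 c2 BU2 E2'' w n).
    fold rate in N1, N2.
    set (G := (m * CInt (fun y => y1 y * u1 y) T - CInt (fun y => y2 y * u1 y) T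
               + CInt (fun y => y1 y * u2 y) T)%C).
    assert (EG : cps b nu = G).
    { unfold cps.
      apply (CSeries_eq _ _ ((Cmod m + 1) * (2 * T * Y * M1) + 2 * T * Y * M2)
               (rate * Cmod nu)).
      - pose proof (Cmod_ge_0 nu). split; [apply Rmult_le_pos; lra|].
        rewrite <- (Rinv_r rate) by lra. apply Rmult_lt_compat_l; lra.
      - intros n.
        pose proof (N1 y1 n c1 BY1) as X1. pose proof (N1 y2 n c2 BY2) as X2.
        pose proof (N2 y1 n c1 BY1) as X3.
        set (q1 := csum (fun k => CInt (fun y => y1 y * iterate y1 y2 y1 k y) T * nu ^ k)%C n) in *.
        set (q2 := csum (fun k => CInt (fun y => y2 y * iterate y1 y2 y1 k y) T * nu ^ k)%C n) in *.
        set (q3 := csum (fun k => CInt (fun y => y1 y * iterate y1 y2 y2 k y) T * nu ^ k)%C n) in *.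
        assert (Es : csum (fun n => b n * nu ^ n)%C n = (m * q1 - q2 + q3)%C).
        { unfold q1, q2, q3, b, L. clear. induction n as [|n IH]; simpl; [ring|].
          rewrite IH. ring. }
        rewrite Es. unfold G.
        match goal with |- Cmod (m * ?a - ?c + ?d - _)%C <= _ =>
          replace (m * a - c + d - (m * q1 - q2 + q3))%C
            with (m * (a - q1) + - (c - q2) + (d - q3))%C by ring end.
        eapply Rle_trans; [apply Cmod_triangle|].
        eapply Rle_trans; [apply Rplus_le_compat_r, Cmod_triangle|].
        rewrite Cmod_opp, Cmod_mult.
        apply (Rmult_le_compat_l (Cmod m)) in X1; [|apply Cmod_ge_0]. lra. }
    rewrite EG. rewrite E2', (E1 T), m1. unfold volterra, G. fold m. rewrite m1. ring.
  - rename H into Hnu, H0 into U1, H1 into U2, H2 into j1, H3 into j2, H4 into j3, H5 into j4.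
    pose proof (lagrange_identity Q nu nu u1 v1 u2 v2 T U1 U2) as E.
    rewrite j1, j2, j3, j4 in E.
    transitivity (u1 T * v2 T - v1 T * u2 T)%C; [ring|]. rewrite E. ring.
Qed.

(** * From the first-order system to Hill's equation *)

(** The hypotheses on fundamental matrices differentiate in the plane; both
    coordinate projections are linear. *)
Lemma is_derive_rderiv (f : R -> C) (t : R) (l : C) :
  @is_derive R_AbsRing C_R_NormedModule f t l -> rderiv f t l.
Proof.
  intros H. split.
  - exact (filterdiff_comp' f (fun z : C_R_NormedModule => fst z) t
      (fun y => scal y l) (fun z => fst z) H
      (filterdiff_linear _ (is_linear_fst (U := R_NormedModule) (V := R_NormedModule)))).
  - exact (filterdiff_comp' f (fun z : C_R_NormedModule => snd z) t
      (fun y => scal y l) (fun z => snd z) H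
      (filterdiff_linear _ (is_linear_snd (U := R_NormedModule) (V := R_NormedModule)))).
Qed.

Lemma entry_Mmult (A B : @matrix C 2 2) i j : (i < 2)%nat -> (j < 2)%nat ->
  entry (Mmult (T := C_Ring) A B) i j =
  (entry A i 0 * entry B 0 j + entry A i 1 * entry B 1 j)%C.
Proof.
  intros Hi Hj. unfold entry, Mmult. rewrite coeff_mat_bij by assumption.
  simpl pred. rewrite sum_Sn, sum_O. reflexivity.
Qed.

Lemma fundamental_columns V c f F lambda z j :
  fundamental_matrix (Amat V c f) F -> (j < 2)%nat ->
  rderiv (fun y => entry (F y lambda) 0 j) z (entry (F z lambda) 1 j) /\
  rderiv (fun y => entry (F y lambda) 1 j) z
    (- ((lambda * lambda + RtoC (Derive_n V 2 (f z))) / RtoC (c ^ 2 - 1))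
       * entry (F z lambda) 0 j
     + RtoC (2 * c) * lambda / RtoC (c ^ 2 - 1) * entry (F z lambda) 1 j)%C.
Proof.
  intros [_ H] Hj. split.
  - eapply rderiv_eq; [apply is_derive_rderiv, (H lambda z 0%nat j); lia|].
    rewrite entry_Mmult by lia. unfold Amat.
    change (0 * entry (F z lambda) 0 j + 1 * entry (F z lambda) 1 j
            = entry (F z lambda) 1 j)%C. ring.
  - eapply rderiv_eq; [apply is_derive_rderiv, (H lambda z 1%nat j); lia|].
    rewrite entry_Mmult by lia. reflexivity.
Qed.

Lemma fundamental_initial V c f F lambda :
  fundamental_matrix (Amat V c f) F ->
  entry (F 0 lambda) 0 0 = 1 /\ entry (F 0 lambda) 0 1 = 0 /\
  entry (F 0 lambda) 1 0 = 0 /\ entry (F 0 lambda) 1 1 = 1.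
Proof. intros [H _]. rewrite H. repeat split. Qed.

Lemma DD_expand F T lambda mu :
  DD F T lambda mu =
  ((entry (F T lambda) 0 0 - mu) * (entry (F T lambda) 1 1 - mu)
   - entry (F T lambda) 0 1 * entry (F T lambda) 1 0)%C.
Proof.
  unfold DD, det2. generalize (F T lambda).
  intros ((a & b & []) & (c & d & []) & []).
  change ((a + - mu) * (d + - mu) - (b + - RtoC 0) * (c + - RtoC 0) =
          (a - mu) * (d - mu) - b * c)%C. ring.
Qed.

Definition hill_potential (V f : R -> R) (c : R) (t : R) : R :=
  - Derive_n V 2 (f t) / (c ^ 2 - 1).

Lemma rderiv_Cexp_line (a : C) (t : R) :
  rderiv (fun s => Cexp (a * RtoC s)%C) t (a * Cexp (a * RtoC t))%C.
Proof.
  pose proof (cderiv_Cexp_scal a t) as H.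
  split; [now apply cderiv_Re_real in H|now apply cderiv_Im_real in H].
Qed.

Lemma hill_solution_scal_plus Q nu u v u' v' (a : C) :
  hill_solution Q nu u v -> hill_solution Q nu u' v' ->
  hill_solution Q nu (fun t => u t + a * u' t)%C (fun t => v t + a * v' t)%C.
Proof.
  intros H H' t. destruct (H t) as [h1 h2], (H' t) as [k1 k2].
  split; (eapply rderiv_eq;
    [apply rderiv_plus; [eassumption|];
     apply (rderiv_mult (fun _ => a)); [apply rderiv_const|eassumption]|]);
    cbv beta; ring.
Qed.

(** The potential Q is real. *)
Lemma hill_solution_Re Q u v :
  hill_solution Q 0 u v ->
  hill_solution Q 0 (fun t => RtoC (Re (u t))) (fun t => RtoC (Re (v t))).
Proof.
  intros H t. destruct (H t) as [[h1 _] [h2 _]].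
  assert (Z : is_derive (fun _ : R => 0) t 0)
    by apply (is_derive_const (V := R_NormedModule) 0).
  split; split.
  - exact h1.
  - exact Z.
  - replace (Re ((RtoC (Q t) + 0) * RtoC (Re (u t)))%C)
      with (Re ((RtoC (Q t) + 0) * u t)%C); [exact h2|].
    destruct (u t). simpl. ring.
  - replace (Im ((RtoC (Q t) + 0) * RtoC (Re (u t)))%C) with 0; [exact Z|].
    simpl. ring.
Qed.

(** The exponential factor removes the first-order term 2 k w' of the equation
    for w; what remains is k^2 - lambda^2 / (c^2 - 1) = lambda^2 / (c^2 - 1)^2. *)
Lemma hill_of_fundamental V c f F lambda j :
  fundamental_matrix (Amat V c f) F -> c ^ 2 - 1 <> 0 -> (j < 2)%nat ->
  let k := (RtoC (c / (c ^ 2 - 1)) * lambda)%C in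
  hill_solution (hill_potential V f c) (lambda * lambda / RtoC ((c ^ 2 - 1) ^ 2))%C
    (fun z => Cexp (- k * RtoC z) * entry (F z lambda) 0 j)%C
    (fun z => Cexp (- k * RtoC z) * (entry (F z lambda) 1 j - k * entry (F z lambda) 0 j))%C.
Proof.
  intros HF Hc Hj k t.
  destruct (fundamental_columns V c f F lambda t j HF Hj) as [W1 W2].
  pose proof (rderiv_Cexp_line (- k)%C t) as X.
  assert (W3 : rderiv (fun z => entry (F z lambda) 1 j - k * entry (F z lambda) 0 j)%C t
    (- ((lambda * lambda + RtoC (Derive_n V 2 (f t))) / RtoC (c ^ 2 - 1))
       * entry (F t lambda) 0 j
     + RtoC (2 * c) * lambda / RtoC (c ^ 2 - 1) * entry (F t lambda) 1 j
     - k * entry (F t lambda) 1 j)%C).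
  { assert (Y : rderiv (fun z => - k * entry (F z lambda) 0 j)%C t
        (- k * entry (F t lambda) 1 j)%C).
    { eapply rderiv_eq.
      - apply (rderiv_mult (fun _ => - k)%C); [apply rderiv_const|exact W1].
      - cbv beta. ring. }
    apply (rderiv_ext (fun z => entry (F z lambda) 1 j + - k * entry (F z lambda) 0 j)%C);
      [intros s; ring|].
    eapply rderiv_eq; [apply rderiv_plus; eassumption|]. ring. }
  assert (Hc' : RtoC (c ^ 2 - 1) <> 0) by (intros E; now apply Hc, RtoC_inj).
  split.
  - eapply rderiv_eq; [apply rderiv_mult; eassumption|]. cbv beta. ring.
  - eapply rderiv_eq; [apply rderiv_mult; eassumption|]. cbv beta.
    unfold hill_potential, k.
    rewrite !RtoC_div, RtoC_pow, RtoC_opp, !RtoC_mult by auto.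
    assert (E : (RtoC c * RtoC c = 1 + RtoC (c ^ 2 - 1))%C).
    { rewrite <- RtoC_mult, <- RtoC_plus. f_equal. ring. }
    set (d := RtoC (c ^ 2 - 1)) in *. set (g := RtoC c) in *.
    set (e := Cexp _). set (w := entry (F t lambda) 0 j). set (w' := entry (F t lambda) 1 j).
    set (V2 := RtoC (Derive_n V 2 (f t))).
    transitivity (e * (lambda * lambda * (g * g - d) / (d * d) - V2 / d) * w)%C.
    + field. exact Hc'.
    + rewrite E. field. exact Hc'.
Qed.

(** * The wave and the characteristic polynomial *)

Lemma Derive_extremum (g : R -> R) (a : R) :
  ex_derive g a -> is_minimizer g a \/ is_maximizer g a -> Derive g a = 0.
Proof.
  intros D H. apply ex_derive_Reals_0 in D.
  rewrite <- (Derive_Reals g a D).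
  destruct H as [H|H].
  - apply (deriv_minimum g (a - 1) (a + 1)); try lra. intros; apply H.
  - apply (deriv_maximum g (a - 1) (a + 1)); try lra. intros; apply H.
Qed.

(** Translates of a wave are waves: differentiating the wave equation in z gives
    Hill's equation with nu = 0. *)
Lemma wave_derivative_hill V E c f :
  potential V -> traveling_wave V E c f -> c ^ 2 - 1 <> 0 ->
  hill_solution (hill_potential V f c) 0
    (fun z => RtoC (Derive f z)) (fun z => RtoC (Derive_n f 2 z)).
Proof.
  intros hV (hf & hode & _) Hc t.
  assert (Z : is_derive (fun _ : R => 0) t 0)
    by apply (is_derive_const (V := R_NormedModule) 0).
  assert (D1 : forall z, is_derive f z (Derive f z))
    by (intros z; apply Derive_correct, (hf 1%nat z); lia).
  split; split; try exact Z.
  - apply Derive_correct, (hf 2%nat t); lia.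
  - assert (DV : is_derive (Derive V) (f t) (Derive_n V 2 (f t))).
    { apply Derive_correct. apply (proj1 (pot_C2 V hV) 2%nat); lia. }
    apply is_derive_ext with (fun z => - / (c ^ 2 - 1) * Derive V (f z)).
    { intros z. cbv beta. change (Re (RtoC (Derive_n f 2 z))) with (Derive_n f 2 z).
      specialize (hode z). apply Rmult_eq_reg_l with (c ^ 2 - 1); [|exact Hc].
      rewrite <- Rmult_assoc, <- Ropp_mult_distr_r, Rinv_r by exact Hc. lra. }
    replace (Re ((RtoC (hill_potential V f c t) + 0) * RtoC (Derive f t))%C)
      with (- / (c ^ 2 - 1) * (Derive f t * Derive_n V 2 (f t)))
      by (unfold hill_potential; set (d := c ^ 2 - 1) in *; simpl; field; exact Hc).
    apply (is_derive_scal (fun z => Derive V (f z)) t (- / (c ^ 2 - 1))).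
    apply (is_derive_comp (Derive V) f t _ _ DV (D1 t)).
  - replace (Im ((RtoC (hill_potential V f c t) + 0) * RtoC (Derive f t))%C) with 0
      by (simpl; ring). exact Z.
Qed.

Lemma GG_c2_neq_1 E c : GG E c -> c ^ 2 - 1 <> 0.
Proof.
  unfold GG, librational, rotational, subluminal_librational, subluminal_rotational,
    superluminal_librational, superluminal_rotational. intros H. lra.
Qed.

(** The wave repeats up to an additive constant, which differentiation removes.
    At z = 0 it passes through an extremum of V, where the equation gives
    f_zz = 0. *)
Lemma wave_endpoints V umin umax E c f T :
  potential V -> is_minimizer V umin -> is_maximizer V umax -> GG E c ->
  periodic_traveling_wave V umin umax E c f T ->
  Derive f T = Derive f 0 /\ Derive_n f 2 0 = 0 /\ Derive_n f 2 T = 0.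
Proof.
  intros hV hmin hmax hG [hw _ _ hper _ hsub hsup].
  pose proof (GG_c2_neq_1 E c hG) as Hc.
  assert (S : exists a, forall z, f (z + T) = f z + a).
  { destruct hper as (_ & hrep & _).
    destruct hrep as [[_ H]|[_ [H|H]]].
    - exists 0. intros z. rewrite H. ring.
    - exists (2 * PI). exact H.
    - exists (- (2 * PI)). intros z. rewrite H. ring. }
  destruct S as (a & Ha). destruct hw as (hf & hode & _).
  assert (P : forall z, Derive f (z + T) = Derive f z).
  { intros z. change (Derive_n f 1 (z + T) = Derive_n f 1 z).
    rewrite <- (Derive_n_comp_trans f 1 z T). simpl.
    rewrite (Derive_ext (fun x => f (x + T)) (fun x => f x + a)) by exact Ha.
    rewrite Derive_plus, Derive_const; [apply Rplus_0_r| |apply ex_derive_const].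
    apply (hf 1%nat z). lia. }
  assert (P2 : Derive_n f 2 (0 + T) = Derive_n f 2 0).
  { change (Derive_n (Derive f) 1 (0 + T) = Derive_n (Derive f) 1 0).
    rewrite <- (Derive_n_comp_trans (Derive f) 1 0 T). simpl.
    apply Derive_ext. exact P. }
  rewrite Rplus_0_l in P2.
  specialize (P 0). rewrite Rplus_0_l in P.
  assert (Q : Derive_n f 2 0 = 0).
  { assert (V0 : Derive V (f 0) = 0).
    { apply Derive_extremum; [apply (proj1 (pot_C2 V hV) 1%nat); lia|].
      destruct (Rlt_or_le (c ^ 2) 1) as [L|L].
      - right. now rewrite (hsub L).
      - left. rewrite hsup by lra. exact hmin. }
    specialize (hode 0). rewrite V0 in hode.
    apply Rmult_eq_reg_l with (c ^ 2 - 1); [lra|exact Hc]. }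
  repeat split; congruence.
Qed.

(** The Wronskians of f_z with the two columns of F(z, 0), and of the columns
    with each other, are constant; evaluated at 0 and T they force F_11 = F_22 = 1 and F_21 = 0 at T.  The solutions of
    Hill's equation with standard data are e^(- k z) (F_11 + k F_12) and
    e^(- k z) F_12; passing to them conjugates the monodromy matrix, up to the
    factor e^(q lambda), so trace and determinant carry over. *)
Lemma characteristic_polynomial V umin umax E c f T F :
  potential V -> is_minimizer V umin -> is_maximizer V umax -> GG E c ->
  periodic_traveling_wave V umin umax E c f T ->
  fundamental_matrix (Amat V c f) F ->
  exists b B, 0 < B /\ radius_ge b B /\
    b O = RtoC (F0 F T 0 1 * RInt (fun y => (F0 F y 0 0) ^ 2) 0 T) /\
    forall lambda mu,
      let nu := (lambda * lambda / RtoC ((c ^ 2 - 1) ^ 2))%C in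
      let e := Cexp (RtoC (q_of c T) * lambda)%C in
      Cmod nu < B ->
      DD F T lambda mu = (mu * mu - e * (2 + nu * cps b nu) * mu + e * e)%C.
Proof.
  intros hV hmin hmax hG hf hF.
  pose proof (GG_c2_neq_1 E c hG) as Hc.
  destruct (wave_endpoints V umin umax E c f T hV hmin hmax hG hf) as (e1 & e2 & e3).
  pose proof (wave_derivative_hill V E c f hV (ptw_wave _ _ _ _ _ _ _ hf) Hc) as SP.
  pose proof (ptw_slope _ _ _ _ _ _ _ hf) as hslope.
  destruct (ptw_period _ _ _ _ _ _ _ hf) as (HT & _).
  set (Q := hill_potential V f c) in *.
  (* k = 0 at lambda = 0, so the columns of F themselves solve Hill's equation *)
  assert (S0 : forall j, (j < 2)%nat ->
    hill_solution Q 0 (fun z => RtoC (F0 F z 0 j)) (fun z => RtoC (F0 F z 1 j))).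
  { intros j Hj.
    pose proof (hill_of_fundamental V c f F 0 j hF Hc Hj) as H. cbv zeta in H.
    apply (hill_solution_Re Q (fun z => entry (F z 0) 0 j) (fun z => entry (F z 0) 1 j)).
    replace (0 * 0 / RtoC ((c ^ 2 - 1) ^ 2))%C with (RtoC 0) in H
      by (unfold Cdiv; ring).
    intros t. destruct (H t) as [H1 H2].
    assert (X : forall s : R, Cexp (- (RtoC (c / (c ^ 2 - 1)) * 0) * RtoC s)%C = 1).
    { intros s. replace (- (RtoC (c / (c ^ 2 - 1)) * 0) * RtoC s)%C with (RtoC 0) by ring.
      apply Cexp_0. }
    split.
    - eapply rderiv_eq; [eapply rderiv_ext; [|exact H1]|];
        [intros s|]; cbv beta; rewrite X; ring.
    - eapply rderiv_eq; [eapply rderiv_ext; [|exact H2]|];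
        [intros s|]; cbv beta; rewrite X; fold Q; ring. }
  pose proof (S0 0%nat ltac:(lia)) as S1. pose proof (S0 1%nat ltac:(lia)) as S2.
  destruct (fundamental_initial V c f F 0 hF) as (i1 & i2 & i3 & i4).
  assert (j1 : RtoC (F0 F 0 0 0) = 1) by (unfold F0; now rewrite i1).
  assert (j2 : RtoC (F0 F 0 0 1) = 0) by (unfold F0; now rewrite i2).
  assert (j3 : RtoC (F0 F 0 1 0) = 0) by (unfold F0; now rewrite i3).
  assert (j4 : RtoC (F0 F 0 1 1) = 1) by (unfold F0; now rewrite i4).
  assert (P0 : RtoC (Derive f 0) <> 0) by (intros X; apply RtoC_inj in X; lra).
  pose proof (lagrange_identity Q 0 0 _ _ _ _ T S1 SP) as L1.
  pose proof (lagrange_identity Q 0 0 _ _ _ _ T S2 SP) as L2.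
  pose proof (lagrange_identity Q 0 0 _ _ _ _ T S1 S2) as L3.
  cbv beta in L1, L2, L3.
  rewrite j1, j3, e1, e2, e3 in L1. rewrite j2, j4, e1, e2, e3 in L2.
  rewrite j1, j2, j3, j4 in L3.
  assert (m2 : RtoC (F0 F T 1 0) = 0).
  { transitivity (- / RtoC (Derive f 0) * (RtoC (F0 F T 0 0) * RtoC 0
       - RtoC (F0 F T 1 0) * RtoC (Derive f 0)))%C; [now field|].
    rewrite L1. ring. }
  assert (m3 : RtoC (F0 F T 1 1) = 1).
  { transitivity (- / RtoC (Derive f 0) * (RtoC (F0 F T 0 1) * RtoC 0
       - RtoC (F0 F T 1 1) * RtoC (Derive f 0)))%C; [now field|].
    rewrite L2. now field. }
  assert (m1 : RtoC (F0 F T 0 0) = 1).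
  { transitivity (RtoC (F0 F T 0 0) * RtoC (F0 F T 1 1)
       - RtoC (F0 F T 1 0) * RtoC (F0 F T 0 1))%C; [rewrite m2, m3; ring|].
    rewrite L3. ring. }
  destruct (hill_discriminant Q _ _ _ _ T HT S1 S2 j1 j3 j2 j4 m1 m2)
    as (b & B & HB & Hrad & Hb0 & Hmain).
  exists b, B. split; [exact HB|]. split; [exact Hrad|]. split.
  { rewrite Hb0, RtoC_mult. f_equal.
    rewrite <- CInt_real. apply CInt_ext. intros y. rewrite <- RtoC_mult.
    f_equal. ring. }
  intros lambda mu nu e Hnu.
  pose proof (hill_of_fundamental V c f F lambda 0 hF Hc ltac:(lia)) as H1.
  pose proof (hill_of_fundamental V c f F lambda 1 hF Hc ltac:(lia)) as H2.
  cbv zeta in H1, H2. fold Q in H1, H2. fold nu in H1, H2.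
  set (k := (RtoC (c / (c ^ 2 - 1)) * lambda)%C) in *.
  pose proof (hill_solution_scal_plus Q nu _ _ _ _ k H1 H2) as H12.
  destruct (fundamental_initial V c f F lambda hF) as (l1 & l2 & l3 & l4).
  assert (X0 : Cexp (- k * RtoC 0)%C = 1).
  { replace (- k * RtoC 0)%C with (RtoC 0) by ring. apply Cexp_0. }
  destruct (Hmain nu _ _ _ _ Hnu H12 H2) as (Tr & Det);
    cbv beta; rewrite ?X0, ?l1, ?l2, ?l3, ?l4; try ring.
  cbv beta in Tr, Det.
  assert (Ee : (e * Cexp (- k * RtoC T) = 1)%C).
  { unfold e. rewrite <- Cexp_plus. rewrite <- Cexp_0. f_equal.
    unfold k, q_of. rewrite !RtoC_div, !RtoC_mult by exact Hc. field.
    intros X. now apply Hc, RtoC_inj. }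
  set (x := Cexp (- k * RtoC T)) in *.
  rewrite DD_expand.
  set (M11 := entry (F T lambda) 0 0) in *. set (M12 := entry (F T lambda) 0 1) in *.
  set (M21 := entry (F T lambda) 1 0) in *. set (M22 := entry (F T lambda) 1 1) in *.
  assert (Tr' : (M11 + M22 = e * (2 + nu * cps b nu))%C).
  { rewrite <- Tr. transitivity (e * x * (M11 + M22))%C; [rewrite Ee; ring|ring]. }
  assert (Det' : (M11 * M22 - M12 * M21 = e * e)%C).
  { transitivity (e * e * (x * x * (M11 * M22 - M12 * M21)))%C.
    - transitivity (e * x * (e * x) * (M11 * M22 - M12 * M21))%C; [rewrite Ee; ring|ring].
    - rewrite <- (Cmult_1_r (e * e)) at 2. f_equal. rewrite <- Det. ring. }
  rewrite <- Tr', <- Det'. ring.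
Qed.

(** * The curves of Floquet multipliers *)

(** A root mu of the characteristic polynomial: the trace is
    e^(q lambda) (2 + lambda^2 H) and lambda S stands for a square root of
    (1 + lambda^2 H / 2)^2 - 1. *)
Definition floquet_branch (q : R) (H S : C -> C) (lambda : C) : C :=
  (Cexp (RtoC q * lambda) * (1 + lambda * lambda * H lambda * RtoC (/ 2) + lambda * S lambda))%C.

Lemma expi_Cexp (theta : R) : expi theta = Cexp (Ci * RtoC theta)%C.
Proof.
  unfold expi, Cexp. simpl.
  replace (0 * theta - 1 * 0) with 0 by ring. replace (0 * 0 + 1 * theta) with theta by ring.
  rewrite exp_0. f_equal; ring.
Qed.

(** The multiplier minus 1 has derivative q + s at 0; the curve is its local
    inverse composed with e^(i theta) - 1. *)
Lemma branch_curve (q R0 : R) (H S : C -> C) (s : C) :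
  0 < R0 -> Csmooth R0 H -> Csmooth R0 S -> S 0 = s -> (q + s)%C <> 0 ->
  exists r0, 0 < r0 /\ forall r, 0 < r <= r0 ->
  exists d gam, 0 < d /\ Csmooth d gam /\ gam 0 = 0 /\
    cderiv gam 0 (Ci / (q + s))%C /\
    (forall z, Cmod z < d -> exists l : C, l <> 0 /\ cderiv gam z l) /\
    (forall theta : R, Rabs theta < d -> forall lambda,
      (Cmod lambda < r /\ floquet_branch q H S lambda = expi theta) <-> lambda = gam theta).
Proof.
  intros HR HH HS S0 Hqs.
  set (Phi := fun l => (floquet_branch q H S l + RtoC (-1))%C).
  assert (SPhi : Csmooth R0 Phi).
  { intros n. unfold Phi, floquet_branch.
    apply Cdiff_plus; [|apply Cdiff_const].
    apply Cdiff_mult; [apply Cdiff_Cexp_scal|].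
    apply Cdiff_plus; [apply Cdiff_plus; [apply Cdiff_const|]|].
    - repeat apply Cdiff_mult; [apply Cdiff_id|apply Cdiff_id|apply HH|apply Cdiff_const].
    - apply Cdiff_mult; [apply Cdiff_id|apply HS]. }
  assert (X0 : forall a : C, Cexp (a * 0)%C = 1).
  { intros a. replace (a * 0)%C with (RtoC 0) by ring. apply Cexp_0. }
  assert (Phi0 : Phi 0 = 0).
  { unfold Phi, floquet_branch. rewrite X0. ring. }
  assert (DPhi : cderiv Phi 0 (q + s)%C).
  { destruct (Csmooth_deriv R0 H 0 HH) as (h' & Hh'); [now rewrite Cmod_0|].
    destruct (Csmooth_deriv R0 S 0 HS) as (s' & Hs'); [now rewrite Cmod_0|].
    eapply cderiv_eq.
    - unfold Phi, floquet_branch.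
      apply (cderiv_plus
        (fun l => Cexp (RtoC q * l) * (1 + l * l * H l * RtoC (/ 2) + l * S l))%C
        (fun _ => RtoC (-1))); [|apply cderiv_const].
      apply (cderiv_mult (fun l => Cexp (RtoC q * l))
        (fun l => 1 + l * l * H l * RtoC (/ 2) + l * S l)%C); [apply cderiv_Cexp_scal|].
      apply (cderiv_plus (fun l => 1 + l * l * H l * RtoC (/ 2))%C (fun l => l * S l)%C).
      + apply (cderiv_plus (fun _ => RtoC 1) (fun l => l * l * H l * RtoC (/ 2))%C);
          [apply cderiv_const|].
        apply (cderiv_mult (fun l => l * l * H l)%C (fun _ => RtoC (/ 2))); [|apply cderiv_const].
        apply (cderiv_mult (fun l => l * l)%C H); [|exact Hh'].
        apply (cderiv_mult (fun l => l) (fun l => l)); apply cderiv_id.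
      + apply (cderiv_mult (fun l => l) S); [apply cderiv_id|exact Hs'].
    - cbv beta. rewrite X0, S0. ring. }
  destruct (inverse_function R0 Phi (q + s)%C HR SPhi Phi0 DPhi Hqs) as (r0 & Hr0 & Hinv).
  exists r0. split; [exact Hr0|]. intros r Hr.
  destruct (Hinv r Hr) as (d0 & g & Hd0 & Sg & g0 & Dg0 & G1 & G2 & G3).
  set (w := fun z : C => (Cexp (Ci * z) + RtoC (-1))%C).
  assert (Sw : forall R1, Csmooth R1 w).
  { intros R1 n. apply Cdiff_plus; [apply Cdiff_Cexp_scal|apply Cdiff_const]. }
  assert (Dw : forall z, cderiv w z (Ci * Cexp (Ci * z))%C).
  { intros z. eapply cderiv_eq.
    - apply (cderiv_plus (fun z => Cexp (Ci * z)%C) (fun _ => RtoC (-1)));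
        [apply cderiv_Cexp_scal|apply cderiv_const].
    - ring. }
  assert (w0 : w 0 = 0) by (unfold w; rewrite X0; ring).
  destruct (Csmooth_continuous_0 1 w Rlt_0_1 (Sw 1) d0 Hd0) as (d & Hd & Bw).
  assert (Bw' : forall z, Cmod z < d -> Cmod (w z) < d0).
  { intros z Hz. specialize (Bw z Hz). rewrite w0 in Bw.
    now replace (w z - 0)%C with (w z) in Bw by ring. }
  exists d, (fun z => g (w z)). repeat match goal with |- _ /\ _ => split end.
  - lra.
  - intros n. apply (Cdiff_comp n d d0 g w); auto. apply Sw.
  - now rewrite w0.
  - eapply cderiv_eq.
    + apply (cderiv_comp g w); [rewrite w0; exact Dg0|apply Dw].
    + rewrite X0. unfold Cdiv. ring.
  - intros z Hz. destruct (G3 _ (Bw' z Hz)) as (l & Hl & Dl).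
    exists (Ci * Cexp (Ci * z) * l)%C. split.
    + apply Cmult_neq_0; [apply Cmult_neq_0|exact Hl].
      * intros E. apply (f_equal snd) in E. simpl in E. lra.
      * apply Cexp_neq_0.
    + now apply (cderiv_comp g w).
  - intros theta Ht lambda.
    assert (Hz : Cmod (RtoC theta) < d) by now rewrite Cmod_R.
    pose proof (Bw' _ Hz) as Hw.
    assert (Ew : forall l, floquet_branch q H S l = expi theta <-> Phi l = w theta).
    { intros l. unfold Phi, w. rewrite expi_Cexp. split; intros E; [now rewrite E|].
      apply (f_equal (fun x => x + 1)%C) in E.
      replace (floquet_branch q H S l)
        with (floquet_branch q H S l + RtoC (-1) + 1)%C by ring.
      rewrite E. ring. }
    split.
    + intros [Hl E]. apply G2; [exact Hl|exact Hw|now apply Ew].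
    + intros ->. destruct (G1 _ Hw) as (A1 & A2). split; [exact A1|now apply Ew].
Qed.

Lemma smooth_curve_of_holomorphic (d d' : R) (gam : C -> C) :
  d' <= d -> Csmooth d gam -> gam 0 = 0 ->
  (forall z, Cmod z < d -> exists l : C, l <> 0 /\ cderiv gam z l) ->
  smooth_curve_through_0 d' (fun t => gam t).
Proof.
  intros Hd Hs H0 Hl. split; [exact H0|]. intros t Ht. split.
  - intros n. apply (Cdiff_ex_derive_n n d gam (Hs n)). lra.
  - destruct (Hl t) as (l & Hn & Dl); [rewrite Cmod_R; lra|].
    unfold velocity.
    rewrite (is_derive_unique _ _ _ (cderiv_Re_real gam t l Dl)).
    rewrite (is_derive_unique _ _ _ (cderiv_Im_real gam t l Dl)).
    now destruct l.
Qed.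

Lemma velocity_of_holomorphic (gam : C -> C) (l : C) :
  cderiv gam 0 l -> velocity (fun t => gam t) 0 = l.
Proof.
  intros Dl. unfold velocity.
  rewrite (is_derive_unique _ _ _ (cderiv_Re_real gam 0 l Dl)).
  rewrite (is_derive_unique _ _ _ (cderiv_Im_real gam 0 l Dl)).
  now destruct l.
Qed.

(** Near the origin the coordinates of gam(t) have the signs of those of t v, and
    the product of the latter does not depend on the sign of t. *)
Lemma holomorphic_quadrant (gam : C -> C) (v : C) :
  gam 0 = 0 -> cderiv gam 0 v -> Re v <> 0 -> Im v <> 0 ->
  exists d, 0 < d /\ forall t : R, Rabs t < d -> t <> 0 ->
    0 < (Re v * Im v) * (Re (gam t) * Im (gam t)).
Proof.
  intros H0 Dv Hx Hy.
  assert (P : forall (p : R -> R) (x : R), p 0 = 0 -> is_derive p 0 x -> x <> 0 ->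
    exists d, 0 < d /\ forall t, Rabs t < d -> t <> 0 -> 0 < x * t * p t).
  { intros p x p0 Dp Hx0. pose proof (Rabs_pos_lt x Hx0) as Hax.
    destruct (is_derive_bound_0 p x Dp (Rabs x / 2)) as (d & Hd & B); [lra|].
    exists d. split; [exact Hd|]. intros t Ht Ht0.
    specialize (B t Ht). rewrite p0 in B.
    pose proof (Rabs_pos_lt t Ht0) as Hat.
    assert (E : Rabs (x * t * (p t - 0 - t * x)) <= (Rabs x * Rabs t) * (Rabs x * Rabs t) / 2).
    { rewrite !Rabs_mult.
      replace (Rabs x * Rabs t * (Rabs x * Rabs t) / 2)
        with (Rabs x * Rabs t * (Rabs x / 2 * Rabs t)) by field.
      apply Rmult_le_compat_l; [nra|exact B]. }
    assert (E2 : (Rabs x * Rabs t) * (Rabs x * Rabs t) = (x * t) * (x * t)).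
    { rewrite <- !Rabs_mult. now rewrite Rabs_pos_eq by (apply Rle_0_sqr). }
    assert (E3 : 0 < (Rabs x * Rabs t) * (Rabs x * Rabs t))
      by (repeat apply Rmult_lt_0_compat; assumption).
    apply Rabs_le_between in E. rewrite E2 in E, E3. nra. }
  destruct (P (fun t => Re (gam t)) (Re v)) as (d1 & Hd1 & B1); auto.
  { now rewrite H0. } { now apply cderiv_Re_real. }
  destruct (P (fun t => Im (gam t)) (Im v)) as (d2 & Hd2 & B2); auto.
  { now rewrite H0. } { now apply cderiv_Im_real. }
  exists (Rmin d1 d2). split; [now apply Rmin_glb_lt|]. intros t Ht Ht0.
  assert (T1 : Rabs t < d1) by (eapply Rlt_le_trans; [exact Ht|apply Rmin_l]).
  assert (T2 : Rabs t < d2) by (eapply Rlt_le_trans; [exact Ht|apply Rmin_r]).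
  specialize (B1 t T1 Ht0). specialize (B2 t T2 Ht0).
  pose proof (Rmult_lt_0_compat _ _ B1 B2) as B.
  assert (Htt : 0 < t * t) by nra.
  apply Rmult_lt_reg_l with (t * t); [exact Htt|]. lra.
Qed.

(** The characteristic polynomial splits into the two branches built on S and
    - S.  The radius d may be decreased freely for a fixed disc. *)
Lemma two_branches (D : C -> C -> C) (q R0 : R) (H : C -> C) (s : C) :
  0 < R0 -> Csmooth R0 H -> H 0 = (s * s)%C -> s <> 0 ->
  (q + s)%C <> 0 -> (q + - s)%C <> 0 ->
  (forall lambda mu, Cmod lambda < R0 ->
     let e := Cexp (RtoC q * lambda)%C in
     D lambda mu = (mu * mu - e * (2 + lambda * lambda * H lambda) * mu + e * e)%C) ->
  exists (d0 r : R) (g1 g2 : C -> C), 0 < d0 /\ 0 < r /\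
    g1 0 = 0 /\ g2 0 = 0 /\
    cderiv g1 0 (Ci / (q + s))%C /\ cderiv g2 0 (Ci / (q + - s))%C /\
    forall d, 0 < d <= d0 ->
    smooth_curve_through_0 d (fun t => g1 t) /\ smooth_curve_through_0 d (fun t => g2 t) /\
    described_by D d r (fun t => g1 t) (fun t => g2 t).
Proof.
  intros HR HH H0 Hs Hp Hm HD.
  (* P = (Delta^2 - 4) / (4 lambda^2) for Delta = 2 + lambda^2 H *)
  set (P := fun l : C => (H l + l * l * (H l * H l * RtoC (/ 4)))%C).
  assert (SP : Csmooth R0 P).
  { intros n. repeat first [apply Cdiff_plus | apply Cdiff_mult | apply Cdiff_id
      | apply Cdiff_const | apply HH]. }
  assert (P0 : P 0 = (s * s)%C) by (unfold P; rewrite H0; ring).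
  destruct (smooth_sqrt R0 P s HR SP P0 Hs) as (R1 & S & HR1 & SS & S0 & ES).
  assert (HH1 : Csmooth R1 H) by (intros n; eapply Cdiff_shrink; [|apply HH]; lra).
  assert (SS' : Csmooth R1 (fun l => RtoC (-1) * S l)%C)
    by (intros n; apply Cdiff_mult; [apply Cdiff_const|apply SS]).
  assert (S0' : (RtoC (-1) * S 0 = - s)%C) by (rewrite S0; ring).
  destruct (branch_curve q R1 H S s) as (ra & Hra & Ba); auto; [lra|].
  destruct (branch_curve q R1 H _ (- s)%C (proj1 HR1) HH1 SS' S0' Hm) as (rb & Hrb & Bb).
  set (r := Rmin R1 (Rmin ra rb)).
  assert (Hr : 0 < r) by (repeat apply Rmin_glb_lt; lra).
  assert (Hr1 : r <= R1) by apply Rmin_l.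
  assert (Hr2 : r <= ra) by (eapply Rle_trans; [apply Rmin_r|apply Rmin_l]).
  assert (Hr3 : r <= rb) by (eapply Rle_trans; [apply Rmin_r|apply Rmin_r]).
  destruct (Ba r) as (da & ga & Hda & Sa & a0 & Da & La & Ea); [lra|].
  destruct (Bb r) as (db & gb & Hdb & Sb & b0 & Db & Lb & Eb); [lra|].
  exists (Rmin da db), r, ga, gb.
  pose proof (Rmin_l da db). pose proof (Rmin_r da db).
  split; [now apply Rmin_glb_lt|]. do 5 (split; [assumption|]).
  intros d Hd.
  split; [apply (smooth_curve_of_holomorphic da d ga); auto; lra|].
  split; [apply (smooth_curve_of_holomorphic db d gb); auto; lra|].
  intros theta Ht lambda.
  specialize (Ea theta ltac:(lra) lambda). specialize (Eb theta ltac:(lra) lambda).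
  assert (Fact : Cmod lambda < r -> D lambda (expi theta) =
    ((expi theta - floquet_branch q H S lambda)
     * (expi theta - floquet_branch q H (fun l => RtoC (-1) * S l)%C lambda))%C).
  { intros Hl. rewrite HD by lra. cbv zeta. unfold floquet_branch.
    assert (El := ES lambda ltac:(lra)). unfold P in El.
    set (e := Cexp (q * lambda)) in *. set (h := H lambda) in *. set (x := S lambda) in *.
    set (mu := expi theta).
    assert (h2 : (RtoC (/ 2) + RtoC (/ 2) = 1)%C) by (rewrite <- RtoC_plus; f_equal; field).
    assert (h4 : (RtoC (/ 2) * RtoC (/ 2) = RtoC (/ 4))%C)
      by (rewrite <- RtoC_mult; f_equal; field).
    transitivity (mu * mu - e * (2 + lambda * lambda * h * (RtoC (/ 2) + RtoC (/ 2))) * mu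
       + e * e * (1 + lambda * lambda * h * (RtoC (/ 2) + RtoC (/ 2))
                  + lambda * lambda * (lambda * lambda * (h * h * (RtoC (/ 2) * RtoC (/ 2)))
                      - x * x)))%C; [|ring].
    rewrite h2, h4, El. ring. }
  split.
  - intros [Hl E]. rewrite (Fact Hl) in E.
    destruct (Ceq_dec (expi theta - floquet_branch q H S lambda)%C 0) as [Z|Z].
    + left. apply Ea. split; [exact Hl|]. symmetry. now apply Ceq_minus.
    + right. apply Eb. split; [exact Hl|]. symmetry. apply Ceq_minus.
      destruct (Ceq_dec (expi theta
        - floquet_branch q H (fun l => RtoC (-1) * S l)%C lambda)%C 0) as [Z'|Z']; [exact Z'|].
      now apply (Cmult_neq_0 _ _ Z) in Z'.
  - intros [E|E].
    + apply Ea in E as [Hl E]. split; [exact Hl|]. rewrite (Fact Hl), E. ring.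
    + apply Eb in E as [Hl E]. split; [exact Hl|]. rewrite (Fact Hl), E. ring.
Qed.

(** * The two regimes *)

Lemma cps_0 b : cps b 0 = b O.
Proof.
  unfold cps. apply (CSeries_eq _ _ (Cmod (b O)) (/ 2)); [lra|].
  assert (E : forall n, csum (fun n => b n * 0 ^ n)%C (S n) = b O).
  { induction n as [|n IH]; [simpl; ring|].
    change (csum (fun n => b n * 0 ^ n)%C (S (S n)))
      with (csum (fun n => b n * 0 ^ n)%C (S n) + b (S n) * 0 ^ S n)%C.
    rewrite IH, Cpow_S. ring. }
  intros [|n].
  - simpl. replace (b O - 0)%C with (b O) by ring. lra.
  - rewrite E. replace (b O - b O)%C with (RtoC 0) by ring. rewrite Cmod_0.
    apply Rmult_le_pos; [apply Cmod_ge_0|apply pow_le; lra].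
Qed.

(** Strict positivity is only available at the endpoint, where continuity
    spreads it to a short interval. *)
Lemma RInt_pos_at_0 (g : R -> R) (T : R) :
  0 < T -> (forall t, continuous g t) -> (forall t, 0 <= g t) -> 0 < g 0 ->
  0 < RInt g 0 T.
Proof.
  intros HT Hc Hn H0.
  destruct (Hc 0 (fun y => Rabs (y - g 0) < g 0 / 2)) as [e He].
  { assert (Hp : 0 < g 0 / 2) by lra. exists (mkposreal _ Hp). intros y Hy. exact Hy. }
  set (d := Rmin (e / 2) T).
  assert (Hd : 0 < d) by (apply Rmin_glb_lt; [|exact HT]; destruct e; simpl; lra).
  assert (Hd1 : d <= e / 2) by apply Rmin_l. assert (Hd2 : d <= T) by apply Rmin_r.
  assert (Hi : forall a b, ex_RInt g a b)
    by (intros a b; apply (ex_RInt_continuous (V := R_CompleteNormedModule)); auto).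
  rewrite <- (RInt_Chasles g 0 d T) by auto.
  change (0 < RInt g 0 d + RInt g d T).
  assert (0 < RInt g 0 d).
  { apply RInt_gt_0; [exact Hd| |auto]. intros x Hx.
    assert (B : Rabs (g x - g 0) < g 0 / 2).
    { apply He. change (Rabs (x - 0) < e). rewrite Rabs_pos_eq; lra. }
    apply Rabs_def2 in B. lra. }
  assert (0 <= RInt g d T) by (apply RInt_ge_0; auto). lra.
Qed.

(** F_11(0, 0) = 1.  Hence kappa has the sign of M_12(0). *)
Lemma F11_energy_positive V c f F T : fundamental_matrix (Amat V c f) F -> 0 < T ->
  0 < RInt (fun y => (F0 F y 0 0) ^ 2) 0 T.
Proof.
  intros HF HT. apply RInt_pos_at_0; auto.
  - intros t. apply (ex_derive_continuous (V := R_NormedModule)).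
    destruct (fundamental_columns V c f F 0 t 0 HF ltac:(lia)) as [[H1 _] _].
    exists (2 * Re (entry (F t 0) 1 0) * F0 F t 0 0 ^ 1).
    apply (is_derive_pow (fun y => F0 F y 0 0) 2 t _ H1).
  - intros t. apply pow2_ge_0.
  - destruct (fundamental_initial V c f F 0 HF) as (E & _).
    unfold F0. rewrite E. simpl. lra.
Qed.

Lemma DD_normal_form V umin umax E c f T F :
  potential V -> is_minimizer V umin -> is_maximizer V umax -> GG E c ->
  periodic_traveling_wave V umin umax E c f T ->
  fundamental_matrix (Amat V c f) F ->
  exists R0 H, 0 < R0 /\ Csmooth R0 H /\ H 0 = RtoC (kappa_of F c T) /\
    forall lambda mu, Cmod lambda < R0 ->
      let e := Cexp (RtoC (q_of c T) * lambda)%C in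
      DD F T lambda mu = (mu * mu - e * (2 + lambda * lambda * H lambda) * mu + e * e)%C.
Proof.
  intros hV hmin hmax hG hf hF.
  pose proof (GG_c2_neq_1 E c hG) as Hc.
  destruct (characteristic_polynomial V umin umax E c f T F hV hmin hmax hG hf hF)
    as (b & B & HB & Hrad & Hb0 & Hmain).
  set (a := (c ^ 2 - 1) ^ 2).
  assert (Ha : 0 < a) by (unfold a; apply pow2_gt_0; exact Hc).
  assert (Ha' : RtoC a <> 0) by (intros X; apply RtoC_inj in X; lra).
  set (R0 := Rmin 1 (B * a)).
  assert (HR : 0 < R0) by (apply Rmin_glb_lt; [lra|now apply Rmult_lt_0_compat]).
  assert (Hnu : forall l, Cmod l < R0 -> Cmod (l * l * / RtoC a)%C < B).
  { intros l Hl. assert (L1 : Cmod l < 1) by (eapply Rlt_le_trans; [exact Hl|apply Rmin_l]).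
    assert (L2 : Cmod l < B * a) by (eapply Rlt_le_trans; [exact Hl|apply Rmin_r]).
    pose proof (Cmod_ge_0 l).
    rewrite !Cmod_mult, Cmod_inv, Cmod_R, Rabs_pos_eq by (lra || assumption).
    apply Rmult_lt_reg_r with a; [exact Ha|].
    rewrite Rmult_assoc, Rinv_l by lra. nra. }
  exists R0, (fun l => cps b (l * l * / RtoC a) * / RtoC a)%C.
  split; [exact HR|]. split; [|split].
  - intros n. apply Cdiff_mult; [|apply Cdiff_const].
    apply (Cdiff_comp n R0 B (cps b) (fun l => l * l * / RtoC a)%C Hnu).
    + now apply Cdiff_cps.
    + apply Cdiff_mult; [apply Cdiff_mult; apply Cdiff_id|apply Cdiff_const].
  - replace (0 * 0 * / RtoC a)%C with (RtoC 0) by ring.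
    rewrite cps_0, Hb0. rewrite <- RtoC_inv by lra. rewrite <- RtoC_mult. f_equal.
    unfold kappa_of, a. field. exact Hc.
  - intros lambda mu Hl e. unfold e.
    rewrite Hmain by (apply Hnu; exact Hl).
    fold a. unfold Cdiv. ring.
Qed.

Theorem lemma6p12
  (V : R -> R) (umin umax : R) (E c : R) (f : R -> R) (T : R)
  (F : R -> C -> @matrix C 2 2)
  (hV : potential V)
  (humin : is_minimizer V umin) (humax : is_maximizer V umax)
  (hEc : GG E c)
  (hf : periodic_traveling_wave V umin umax E c f T)
  (hF : fundamental_matrix (Amat V c f) F)
  (hc : c <> 0) :
  (rho_of F T = 1 -> kappa_of F c T <> (q_of c T) ^ 2 ->
     two_tangent_curves (DD F T)) /\
  (rho_of F T = -1 -> two_crossing_curves (DD F T)).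
Proof.
  pose proof (GG_c2_neq_1 E c hEc) as Hc.
  destruct (ptw_period _ _ _ _ _ _ _ hf) as (HT & _).
  pose proof (F11_energy_positive V c f F T hF HT) as HI.
  destruct (DD_normal_form V umin umax E c f T F hV humin humax hEc hf hF)
    as (R0 & H & HR & HH & H0 & HD).
  assert (Hq : q_of c T <> 0).
  { unfold q_of, Rdiv. apply Rmult_integral_contrapositive_currified.
    - apply Rmult_integral_contrapositive_currified; lra.
    - now apply Rinv_neq_0_compat. }
  assert (Hk : exists p, 0 < p /\ kappa_of F c T = p * F0 F T 0 1).
  { exists (/ (c ^ 2 - 1) ^ 2 * RInt (fun y => (F0 F y 0 0) ^ 2) 0 T). split.
    - apply Rmult_lt_0_compat; [|exact HI]. apply Rinv_0_lt_compat, pow2_gt_0, Hc.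
    - unfold kappa_of, Rdiv. ring. }
  destruct Hk as (p & Hp & Hk).
  set (q := q_of c T) in *. set (kappa := kappa_of F c T) in *.
  unfold rho_of. set (m := F0 F T 0 1) in *.
  split.
  - intros Hrho Hkq.
    assert (Hm : 0 < m).
    { destruct (Rtotal_order m 0) as [L|[L|L]]; [| |exact L].
      - rewrite sign_eq_m1 in Hrho by exact L. lra.
      - rewrite L, sign_0 in Hrho. lra. }
    assert (Hkap : 0 < kappa) by (rewrite Hk; now apply Rmult_lt_0_compat).
    set (s := sqrt kappa).
    assert (Hs : 0 < s) by now apply sqrt_lt_R0.
    assert (Hss : s * s = kappa) by (apply sqrt_sqrt; lra).
    assert (N1 : q + s <> 0) by (intros X; apply Hkq; rewrite <- Hss; nra).
    assert (N2 : q + - s <> 0) by (intros X; apply Hkq; rewrite <- Hss; nra).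
    assert (Re_vel : forall x : R, x <> 0 -> Re (Ci / RtoC x)%C = 0).
    { intros x Hx. unfold Cdiv. rewrite <- RtoC_inv by exact Hx. simpl. ring. }
    destruct (two_branches (DD F T) q R0 H (RtoC s) HR HH) as
      (d & r & g1 & g2 & Hd & Hr & _ & _ & D1 & D2 & Hcurves).
    + rewrite H0, <- RtoC_mult. now f_equal.
    + intros X. apply RtoC_inj in X. lra.
    + rewrite <- RtoC_plus. intros X. now apply RtoC_inj in X.
    + rewrite <- RtoC_opp, <- RtoC_plus. intros X. now apply RtoC_inj in X.
    + exact HD.
    + destruct (Hcurves d) as (C1 & C2 & C3); [lra|].
      exists d, r, (fun t => g1 t), (fun t => g2 t).
      do 5 (split; [assumption|]). unfold tangent_to_imaginary_axis.
      rewrite (velocity_of_holomorphic _ _ D1), (velocity_of_holomorphic _ _ D2).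
      rewrite <- RtoC_opp, <- !RtoC_plus. split; now apply Re_vel.
  - intros Hrho.
    assert (Hm : m < 0).
    { destruct (Rtotal_order m 0) as [L|[L|L]]; [exact L| |].
      - rewrite L, sign_0 in Hrho. lra.
      - rewrite sign_eq_1 in Hrho by exact L. lra. }
    assert (Hkap : 0 < - kappa) by (rewrite Hk; nra).
    set (s := sqrt (- kappa)).
    assert (Hs : 0 < s) by now apply sqrt_lt_R0.
    assert (Hss : s * s = - kappa) by (apply sqrt_sqrt; lra).
    set (n := q * q + s * s).
    assert (Hn : 0 < n) by (unfold n; nra).
    set (v1 := (s / n, q / n) : C). set (v2 := (- s / n, q / n) : C).
    assert (Nz : forall x y : R, x <> 0 -> (x, y) <> RtoC 0)
      by (intros x y Hx X; apply Hx; exact (f_equal fst X)).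
    assert (Z1 : (RtoC q + (0, s))%C <> 0) by (apply Nz; simpl; lra).
    assert (Z2 : (RtoC q + - (0, s))%C <> 0) by (apply Nz; simpl; lra).
    assert (V1 : (Ci / (RtoC q + (0, s)))%C = v1).
    { transitivity (v1 * (RtoC q + (0, s)) / (RtoC q + (0, s)))%C; [|now field].
      unfold Cdiv. f_equal. unfold v1, n. apply injective_projections; simpl; field; unfold n in Hn; lra. }
    assert (V2 : (Ci / (RtoC q + - (0, s)))%C = v2).
    { transitivity (v2 * (RtoC q + - (0, s)) / (RtoC q + - (0, s)))%C; [|now field].
      unfold Cdiv. f_equal. unfold v2, n. apply injective_projections; simpl; field; unfold n in Hn; lra. }
    destruct (two_branches (DD F T) q R0 H (0, s) HR HH) as
      (d0 & r & g1 & g2 & Hd0 & Hr & G1 & G2 & D1 & D2 & Hcurves); auto.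
    { rewrite H0. unfold RtoC, Cmult. simpl. f_equal; lra. }
    { intros X. apply (f_equal snd) in X. simpl in X. lra. }
    rewrite V1 in D1. rewrite V2 in D2.
    assert (Hsn : 0 < s / n) by now apply Rdiv_lt_0_compat.
    assert (Hqn : q / n <> 0).
    { unfold Rdiv. apply Rmult_integral_contrapositive_currified; [exact Hq|].
      apply Rinv_neq_0_compat. lra. }
    destruct (holomorphic_quadrant g1 v1 G1 D1) as (d1 & Hd1 & Q1); [simpl; lra|exact Hqn|].
    destruct (holomorphic_quadrant g2 v2 G2 D2) as (d2 & Hd2 & Q2);
      [simpl; rewrite Rdiv_opp_l; lra|exact Hqn|].
    simpl in Q1, Q2. rewrite Rdiv_opp_l in Q2.
    set (d := Rmin d0 (Rmin d1 d2)).
    assert (Hd : 0 < d) by (repeat apply Rmin_glb_lt; assumption).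
    assert (L0 : d <= d0) by apply Rmin_l.
    assert (L1 : d <= d1) by (eapply Rle_trans; [apply Rmin_r|apply Rmin_l]).
    assert (L2 : d <= d2) by (eapply Rle_trans; [apply Rmin_r|apply Rmin_r]).
    clearbody d.
    destruct (Hcurves d) as (C1 & C2 & C3); [lra|].
    exists d, r, (fun t => g1 t), (fun t => g2 t).
    do 5 (split; [assumption|]).
    rewrite (velocity_of_holomorphic _ _ D1), (velocity_of_holomorphic _ _ D2).
    split; [|split].
    + (* on g1 the product of the coordinates has the sign of q, on g2 it does not *)
      intros e He Heq.
      destruct (proj1 (Heq (g1 (RtoC (e / 2))))) as (t & Ht & Et).
      { exists (e / 2). split; [rewrite Rabs_pos_eq; lra|reflexivity]. }
      specialize (Q1 (e / 2)). rewrite Rabs_pos_eq in Q1 by lra.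
      specialize (Q1 ltac:(lra) ltac:(lra)).
      rewrite <- Et in Q1.
      destruct (Req_dec t 0) as [->|Hn0].
      * rewrite G2 in Q1. simpl in Q1. lra.
      * specialize (Q2 t ltac:(lra) Hn0). simpl in Q1, Q2. lra.
    + unfold parallel, v1, v2. simpl. rewrite Rdiv_opp_l. intros X.
      assert (Y : s / n * (q / n) = 0) by lra.
      apply Rmult_integral in Y. lra.
    + assert (A : forall x : R, x <> 0 -> 0 < angle_with_imaginary_axis (x, q / n) < PI / 2).
      { intros x Hx. unfold angle_with_imaginary_axis. simpl Im.
        set (y := q / n) in *.
        pose proof (Rabs_pos_lt y Hqn) as Hy.
        assert (Hlt : Rabs y < Cmod (x, y)).
        { unfold Cmod. simpl fst. simpl snd. rewrite <- sqrt_Rsqr_abs.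
          apply sqrt_lt_1_alt. unfold Rsqr. split; [nra|].
          assert (0 < x * x) by nra. simpl. lra. }
        set (u := Rabs y / Cmod (x, y)).
        assert (Hu : 0 < u < 1).
        { unfold u. split; [apply Rdiv_lt_0_compat; lra|].
          apply Rmult_lt_reg_r with (Cmod (x, y)); [lra|].
          unfold Rdiv. rewrite Rmult_assoc, Rinv_l; lra. }
        pose proof (acos_bound_lt u ltac:(lra)) as B.
        split; [lra|]. apply Rnot_le_lt. intros L.
        pose proof (cos_le_0 (acos u) L ltac:(lra)) as X.
        rewrite cos_acos in X by lra. lra. }
      split; apply A; [lra|]. rewrite Rdiv_opp_l. lra.
Qed.
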